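(* $(\Lambda(R^+),d)$ and $(\Lambda(R^+),\delta)$ are respectively a diamond chain complex and a diamond cochain complex with basis graph $\Gamma(R^+)$.
   Context: $R^+$ is the positive root system of a semisimple Lie algebra over $\mathbb C$. The free abelian group on $R^+$ carries the Lie algebra structure over $\mathbb Z$ of the positive root system, with bracket of basis elements $[e,e']=\pm(e+e')$ (meaning $\pm$ the basis element $e+e'$) if $e+e'\in R^+$, and $[e,e']=0$ otherwise. $\Lambda(R^+)$ is the exterior algebra over $\mathbb Z$ on generators $(e)$, $e\in R^+$, graded by $|(e_1)\cdots(e_n)|=n$, $|1|=0$. The chain complex $(\Lambda(R^+),d)$ has $d(e)=0$ for $e\in R^+$ and, for $n>1$, $$d((e_1)\cdots(e_n))=\sum_{i<j}(-1)^{j-i-1}([e_i,e_j])(e_1)\cdots\widehat{(e_i)}\cdots\widehat{(e_j)}\cdots(e_n),$$ where hats denote omission, $(-e)=-(e)$ and $(0)=0$. Basis graph $\Gamma(R^+)$: its vertices are all subsets of $R^+$ (including $\emptyset$); $\{\sigma,\tau\}$ is an edge iff there are $e,e_1,e_2\in R^+$ with $e=e_1+e_2$ such that either $\sigma\setminus\tau=\{e\}$ and $\tau\setminus\sigma=\{e_1,e_2\}$, or $\tau\setminus\sigma=\{e\}$ and $\sigma\setminus\tau=\{e_1,e_2\}$. The degree of a vertex is $|\sigma|$, its cardinality. Given a total order on $R^+$, $\sigma\subseteq R^+$ is identified with the ordered product $\prod_{e\in\sigma}(e)\in\Lambda(R^+)$ ($\emptyset$ with $1$), so that $\Lambda(R^+)=\mathbb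 Z(\Gamma(R^+))$, the free abelian group on the vertices. $(\Lambda(R^+),\delta)$ is the dual cochain complex, regarded as the same group with the dual differential $\delta$ (the transpose of $d$ in this basis). A (finite) graph $\Gamma$ is a diamond graph if: whenever $a,b,c$ are distinct vertices such that $\{a,b\}$ and $\{b,c\}$ are edges, there is a unique vertex $d\neq b$ such that $\{a,d\}$ and $\{d,c\}$ are edges and $\{a,c\}$ and $\{b,d\}$ are not edges; the full subgraph on $\{a,b,c,d\}$ is a diamond $\langle a;b;c;d\rangle$. It is admissible if there is a sign function $\phi$ from its edges to $\{\pm1\}$ with $\phi(a,b)\phi(b,c)+\phi(a,d)\phi(d,c)=0$ for every diamond $\langle a;b;c;d\rangle$. A diamond chain complex $(C,d)$ with basis graph $\Gamma$ is a chain complex such that $\Gamma$ is an admissible diamond graph with sign function $\phi$, with vertices graded so that $|a|=|b|\pm1$ for every edge $\{a,b\}$; $C=\mathbb Z(\Gamma)$ is the free abelian group on the vertices of $\Gamma$; and $da=\sum_{|b|=|a|-1,\ \{a,b\}\text{ an edge}}\phi(a,b)\,b$ for every vertex $a$. Its dual, regarded as the same group with $\delta a=\sum_{|b|=|a|+1,\ \{a,b\}\text{ an edge}}\phi(a,b)\,b$, is called a diamond cochain complex with basis graph $\Gamma$. *)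

(* Defs.v *)
From HB Require Import structures.
From mathcomp Require Import all_boot all_order all_algebra.

Set Implicit Arguments.
Unset Strict Implicit.
Unset Printing Implicit Defensive.

Import Order.TTheory GRing.Theory Num.Theory.
Local Open Scope ring_scope.

(** * Finitely generated free abelian groups *)

Section FreeAbelian.
Variable T : finType.

Definition zbasis (a : T) : {ffun T -> int} := [ffun x => (x == a)%:R].

Definition zextend (A : zmodType) (f : T -> A) (u : {ffun T -> int}) : A :=
  \sum_x f x *~ u x.

(* The transpose, with respect to the basis [zbasis], of an endomorphism. *)
Definition transpose (f : {ffun T -> int} -> {ffun T -> int})
    (u : {ffun T -> int}) : {ffun T -> int} :=
  zextend (fun a => [ffun b => f (zbasis b) a]) u.

Fact zextend_is_zmod_morphism (A : zmodType) (f : T -> A) :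
  zmod_morphism (zextend f).
Proof.
move=> u v; rewrite /zextend -sumrB; apply: eq_bigr => x _.
by rewrite !ffunE mulrzBr.
Qed.

Fact zextend_basis (A : zmodType) (f : T -> A) a : zextend f (zbasis a) = f a.
Proof.
rewrite /zextend (bigD1 a) //= ffunE eqxx big1 ?addr0 // => x /negPf xa.
by rewrite ffunE xa mulr0z.
Qed.

Fact zbasis_sum (u : {ffun T -> int}) : zextend zbasis u = u.
Proof.
apply/ffunP=> a.
rewrite /zextend sum_ffunE (bigD1 a) //= big1 => [|x /negPf xa].
  by rewrite addr0 ffunMzE ffunE eqxx intz.
by rewrite ffunMzE ffunE eq_sym xa mul0rz.
Qed.

Fact zmod_morphism_zextend (A : zmodType) (F : {ffun T -> int} -> A) :
  zmod_morphism F -> F =1 zextend (F \o zbasis).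
Proof.
move=> FB; pose M := GRing.isZmodMorphism.Build _ _ F FB.
pose G : {additive {ffun T -> int} -> A} := HB.pack F M.
move=> u; rewrite -[u in LHS]zbasis_sum -[F]/(G : _ -> _) raddf_sum.
by apply: eq_bigr => x _; rewrite raddfMz.
Qed.

Fact zextend_eq (A : zmodType) (F G : {ffun T -> int} -> A) :
  zmod_morphism F -> zmod_morphism G ->
  (forall a, F (zbasis a) = G (zbasis a)) -> F =1 G.
Proof.
move=> FB GB FG u; rewrite !(zmod_morphism_zextend FB, zmod_morphism_zextend GB).
by apply: eq_bigr => x _; rewrite /= FG.
Qed.

End FreeAbelian.

(** * Diamond graphs and diamond (co)chain complexes *)

Section Diamond.
Variable T : finType.
Implicit Types (G : rel T) (phi : T -> T -> int) (deg : T -> int).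
Implicit Types (a b c x : T) (d : {ffun T -> int} -> {ffun T -> int}).

Definition simple_graph G := symmetric G /\ irreflexive G.

Definition diamond G a b c x :=
  [/\ [&& a != b, b != c & a != c], G a b && G b c, x != b,
      G a x && G x c & ~~ G a c && ~~ G b x].

Definition diamond_graph G :=
  simple_graph G /\
  forall a b c, [&& a != b, b != c & a != c] -> G a b -> G b c ->
    exists! x, [/\ x != b, G a x && G x c & ~~ G a c && ~~ G b x].

(* A function of edges is a function of ordered pairs that does not depend on
   the order; its values off the edges are irrelevant. *)
Definition sign_function G phi :=
  [/\ forall a b, G a b -> phi a b = 1 \/ phi a b = -1,
      forall a b, G a b -> phi a b = phi b a &
      forall a b c x, diamond G a b c x ->
        phi a b * phi b c + phi a x * phi x c = 0].

Definition graph_grading G deg :=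
  forall a b, G a b -> deg a = deg b + 1 \/ deg a = deg b - 1.

Definition homogeneous deg (n : int) (u : {ffun T -> int}) :=
  forall a, u a != 0 -> deg a = n.

Definition chain_complex deg d :=
  [/\ zmod_morphism d,
      forall n u, homogeneous deg n u -> homogeneous deg (n - 1) (d u) &
      forall u, d (d u) = 0].

Definition cochain_complex deg d :=
  [/\ zmod_morphism d,
      forall n u, homogeneous deg n u -> homogeneous deg (n + 1) (d u) &
      forall u, d (d u) = 0].

Definition diamond_chain_complex G deg d :=
  [/\ chain_complex deg d, diamond_graph G, graph_grading G deg &
      exists2 phi, sign_function G phi &
        forall a, d (zbasis a) =
          \sum_(b | (deg b == deg a - 1) && G a b) zbasis b *~ phi a b].

Definition diamond_cochain_complex G deg d :=
  [/\ cochain_complex deg d, diamond_graph G, graph_grading G deg &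
      exists2 phi, sign_function G phi &
        forall a, d (zbasis a) =
          \sum_(b | (deg b == deg a + 1) && G a b) zbasis b *~ phi a b].

End Diamond.

(** * Exterior algebras over the integers *)

Definition total_order (T : Type) (le : rel T) :=
  [/\ reflexive le, antisymmetric le, transitive le & total le].

(* The exterior algebra on the generators [x : T], in its standard basis: for
   a total order [le] on [T], [zbasis s] is the product of the elements of [s]
   in increasing order ([ext_ordered_prod] below). *)
Definition exterior (T : finType) (le : rel T) := {ffun {set T} -> int}.

HB.instance Definition _ (T : finType) (le : rel T) :=
  GRing.Zmodule.on (exterior le).

Section Exterior.
Variables (T : finType) (le : rel T).
Implicit Types (s t r : {set T}) (x y : T) (u v w : exterior le).

(* The number of transpositions that sort the concatenation of s and t. *)
Definition inversions s t : nat :=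
  \sum_(x in s) \sum_(y in t) ~~ le x y.

Definition ext_mul_basis s t : exterior le :=
  if [disjoint s & t]
  then (zbasis (s :|: t) : exterior le) *~ (-1) ^+ inversions s t else 0.

Definition ext_mul u v : exterior le :=
  zextend (fun s => zextend (ext_mul_basis s) v) u.

Let big_disjU s t (F : T -> nat) : [disjoint s & t] ->
  (\sum_(x in s :|: t) F x = \sum_(x in s) F x + \sum_(x in t) F x)%N.
Proof.
by move=> dst; rewrite -bigU //=; apply: eq_bigl => x; rewrite inE.
Qed.

Let inversionsUl s t r : [disjoint s & t] ->
  inversions (s :|: t) r = (inversions s r + inversions t r)%N.
Proof. by move=> dst; rewrite /inversions big_disjU. Qed.

Let inversionsUr s t r : [disjoint s & t] ->
  inversions r (s :|: t) = (inversions r s + inversions r t)%N.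
Proof.
move=> dst; rewrite /inversions -big_split /=; apply: eq_bigr => x _.
by rewrite big_disjU.
Qed.

Let ext_mulBl w : zmod_morphism (ext_mul^~ w).
Proof. exact: zextend_is_zmod_morphism. Qed.

Let ext_mulBr w : zmod_morphism (ext_mul w).
Proof.
move=> u v; rewrite /ext_mul /zextend -sumrB; apply: eq_bigr => s _.
by rewrite -mulrzBl -zextend_is_zmod_morphism.
Qed.

Fact ext_mul_zbasis s t : ext_mul (zbasis s) (zbasis t) = ext_mul_basis s t.
Proof. by rewrite /ext_mul !zextend_basis. Qed.

Let mulzl u v k : ext_mul (u *~ k) v = ext_mul u v *~ k.
Proof.
pose M := GRing.isZmodMorphism.Build _ _ _ (ext_mulBl v).
pose G : {additive exterior le -> exterior le} := HB.pack (ext_mul^~ v) M.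
exact: (raddfMz G).
Qed.

Let mulzr u v k : ext_mul u (v *~ k) = ext_mul u v *~ k.
Proof.
pose M := GRing.isZmodMorphism.Build _ _ _ (ext_mulBr u).
pose G : {additive exterior le -> exterior le} := HB.pack (ext_mul u) M.
exact: (raddfMz G).
Qed.

Let mulu0 u : ext_mul u 0 = 0.
Proof. by have := mulzr u 0 0; rewrite !mulr0z. Qed.

Let mul0u u : ext_mul 0 u = 0.
Proof. by have := mulzl 0 u 0; rewrite !mulr0z. Qed.

Let disjU s t r : [disjoint s :|: t & r] = [disjoint s & r] && [disjoint t & r].
Proof. by rewrite -!setI_eq0 setIUl setU_eq0. Qed.

Fact ext_mulA : associative ext_mul.
Proof.
move=> u v w; move: u.
apply: zextend_eq; [exact: ext_mulBl | |].
  by move=> u u'; rewrite !ext_mulBl.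
move=> s; move: v; apply: zextend_eq.
- by move=> v v'; rewrite ext_mulBl ext_mulBr.
- by move=> v v'; rewrite ext_mulBr ext_mulBl.
move=> t; move: w; apply: zextend_eq.
- by move=> v v'; rewrite !ext_mulBr.
- by move=> v v'; rewrite !ext_mulBr.
move=> r; rewrite !ext_mul_zbasis /ext_mul_basis.
have [dst|ndst] := boolP [disjoint s & t];
  have [dtr|ndtr] := boolP [disjoint t & r].
- rewrite mulzl mulzr !ext_mul_zbasis /ext_mul_basis disjU dtr andbT.
  rewrite disjoint_sym disjU [[disjoint t & s]]disjoint_sym dst.
  rewrite [[disjoint r & s]]disjoint_sym /=.
  case: ifP => [dsr|_]; last by rewrite !mul0rz.
  rewrite -!mulrzA setUA inversionsUr // inversionsUl // !exprD.
  congr (_ *~ _).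
  by rewrite mulrAC -mulrA mulrAC mulrA [LHS]mulrC mulrA mulrAC.
- rewrite mulu0 mulzl ext_mul_zbasis /ext_mul_basis disjU.
  by rewrite (negPf ndtr) andbF mul0rz.
- rewrite mul0u mulzr ext_mul_zbasis /ext_mul_basis disjoint_sym disjU.
  by rewrite [[disjoint t & s]]disjoint_sym (negPf ndst) mul0rz.
- by rewrite mul0u mulu0.
Qed.

Fact ext_mul1r : left_id (zbasis set0 : exterior le) ext_mul.
Proof.
apply: zextend_eq => [||s]; [exact: ext_mulBr | by [] |].
rewrite ext_mul_zbasis /ext_mul_basis -setI_eq0 set0I eqxx set0U.
by rewrite /inversions big_set0 expr0.
Qed.

Fact ext_mulr1 : right_id (zbasis set0 : exterior le) ext_mul.
Proof.
apply: zextend_eq => [||s]; [exact: ext_mulBl | by [] |].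
rewrite ext_mul_zbasis /ext_mul_basis -setI_eq0 setI0 eqxx setU0.
by rewrite /inversions big1 ?expr0 // => x _; rewrite big_set0.
Qed.

Let ext_mulDl : left_distributive ext_mul +%R.
Proof.
move=> u v w; pose M := GRing.isZmodMorphism.Build _ _ _ (ext_mulBl w).
pose G : {additive exterior le -> exterior le} := HB.pack (ext_mul^~ w) M.
exact: (raddfD G).
Qed.

Let ext_mulDr : right_distributive ext_mul +%R.
Proof.
move=> w u v; pose M := GRing.isZmodMorphism.Build _ _ _ (ext_mulBr w).
pose G : {additive exterior le -> exterior le} := HB.pack (ext_mul w) M.
exact: (raddfD G).
Qed.

HB.instance Definition _ := GRing.Zmodule_isPzRing.Build (exterior le)
  ext_mulA ext_mul1r ext_mulr1 ext_mulDl ext_mulDr.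

Definition ext_gen x : exterior le := zbasis [set x].

Fact ext_gen_sqr x : ext_gen x * ext_gen x = 0.
Proof.
rewrite [LHS]ext_mul_zbasis /ext_mul_basis -setI_eq0 setIid.
by case: ifP => // /eqP/setP/(_ x); rewrite !inE eqxx.
Qed.

Fact ext_gen_anticomm x y :
  total_order le -> ext_gen x * ext_gen y = - (ext_gen y * ext_gen x).
Proof.
case=> _ anti _ tot.
have [->|xy] := eqVneq x y; first by rewrite ext_gen_sqr oppr0.
rewrite [X in X = _]ext_mul_zbasis [X in - X]ext_mul_zbasis /ext_mul_basis.
rewrite !disjoints1 !inE eq_sym (eq_sym y) xy setUC /inversions !big_set1.
case lexy: (le x y); case leyx: (le y x); last 1 first.
- by have := tot x y; rewrite lexy leyx.
- by case/eqP: xy; apply: anti; rewrite lexy leyx.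
- by rewrite expr0 expr1 mulrNz opprK.
- by rewrite expr0 expr1 mulrNz.
Qed.

Definition ordered_seq s : seq T := sort le (enum s).

Fact ext_sorted_prod (l : seq T) : transitive le -> sorted le l -> uniq l ->
  \prod_(x <- l) ext_gen x = zbasis [set x in l].
Proof.
move=> tr; elim: l => [|x l IH] sl ul; first by rewrite big_nil.
move: ul; rewrite cons_uniq => /andP[xl ul].
rewrite big_cons IH ?(path_sorted sl) // [LHS]ext_mul_zbasis /ext_mul_basis.
rewrite disjoints1 inE xl set_cons /inversions big_set1 big1 ?expr0 // => y.
by rewrite inE => yl; have /allP/(_ y yl) -> := order_path_min tr sl.
Qed.

Fact ext_ordered_prod s :
  total_order le -> \prod_(x <- ordered_seq s) ext_gen x = zbasis s.
Proof.
case=> _ _ tr tot; rewrite ext_sorted_prod ?sort_sorted ?sort_uniq ?enum_uniq //.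
by congr zbasis; apply/setP=> x; rewrite inE mem_sort mem_enum.
Qed.

End Exterior.

(** * The chain complex of a Lie ring structure on a free abelian group *)

Definition lie_bracket (A : zmodType) (br : A -> A -> A) :=
  [/\ forall u, zmod_morphism (br u),
      forall v, zmod_morphism (br^~ v),
      forall u, br u u = 0 &
      forall u v w, br u (br v w) + br v (br w u) + br w (br u v) = 0].

Section ChainComplex.
Variables (T : finType) (le : rel T).
Variable br : {ffun T -> int} -> {ffun T -> int} -> {ffun T -> int}.

Definition ext_lin (u : {ffun T -> int}) : exterior le :=
  zextend (@ext_gen T le) u.

(* The value of the differential on the product of the sequence l. *)
Definition ext_d_seq (l : seq T) : exterior le :=
  let e := tnth (in_tuple l) in
  \sum_(i < size l) \sum_(j < size l | (i < j)%N)
    (ext_lin (br (zbasis (e i)) (zbasis (e j))) *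
       \prod_(k < size l | (k != i) && (k != j)) ext_gen le (e k))
      *~ (-1) ^+ (j - i - 1).

Definition ext_d : exterior le -> exterior le :=
  zextend (fun s : {set T} => ext_d_seq (ordered_seq le s)).

End ChainComplex.

Arguments ext_d {T} le br u.

(** * Root systems *)

Section RootSystem.
Variables (F : realFieldType) (V : vectType F) (B : V -> V -> F).

Definition inner_product :=
  [/\ forall u v, B u v = B v u,
      forall k u v w, B (k *: u + v) w = k * B u w + B v w &
      forall u, u != 0 -> 0 < B u u].

(* Reduced crystallographic root systems, i.e. the root systems of semisimple
   Lie algebras over the complex numbers; R is used as a set. *)
Definition root_system (R : seq V) :=
  [/\ <<R>>%VS = fullv /\ 0 \notin R,
      forall a k, a \in R -> k *: a \in R -> k = 1 \/ k = -1,
      forall a b, a \in R -> b \in R -> b - (2 * B b a / B a a) *: a \in R &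
      forall a b, a \in R -> b \in R ->
        exists m : int, 2 * B b a / B a a = m%:~R].

Definition positive_system (R Rp : seq V) :=
  [/\ {subset Rp <= R},
      forall a, a \in R -> (a \in Rp) (+) (- a \in Rp) &
      forall a b, a \in Rp -> b \in Rp -> a + b \in R -> a + b \in Rp].

End RootSystem.

(* Positive roots are the elements of the finite type [seq_sub Rp]; [val] is
   its inclusion into V. *)
Section PositiveRoots.
Variables (F : realFieldType) (V : vectType F) (Rp : seq V).
Local Notation P := (seq_sub Rp).

Definition root_bracket
    (br : {ffun P -> int} -> {ffun P -> int} -> {ffun P -> int}) :=
  [/\ lie_bracket br,
      forall e1 e2 e : P, val e = val e1 + val e2 ->
        br (zbasis e1) (zbasis e2) = zbasis e \/
        br (zbasis e1) (zbasis e2) = - zbasis e &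
      forall e1 e2 : P, val e1 + val e2 \notin Rp ->
        br (zbasis e1) (zbasis e2) = 0].

Definition root_graph : rel {set P} := fun s t =>
  [exists e : P, exists e1 : P, exists e2 : P,
    (val e == val e1 + val e2) &&
    ((s :\: t == [set e]) && (t :\: s == [set e1; e2]) ||
     (t :\: s == [set e]) && (s :\: t == [set e1; e2]))].

End PositiveRoots.

Arguments root_graph {F V} Rp s t.

(* Main.v *)
(* Flipping. Give each positive root x the sign + or - according to whether it
   belongs to a set a. Then {a, b} is an edge if and only if the symmetric
   difference of a and b has three elements whose signed sum in a is zero. Hence
   the two steps of a path from a to c <> a flip two triples with at most one
   common element. If they are disjoint, the only other path from a to c flips
   them in the opposite order. Otherwise a and c differ by four signed roots
     with
   sum zero, and the paths from a to c correspond to the ways of grouping these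
   in pairs whose sums are roots. The inner product excludes a single such
   grouping, and the Jacobi identity with root strings exclude three.

   Signs. Up to a factor depending on the direction of the edge, its coefficient
   in d is an alternating function of the triple it flips, times the sign of a
   product of three anticommuting involutions of the exterior algebra. In the
   first kind of diamond these products of odd length anticommute. In the second
   kind, the six roots involved are, up to sign, the differences of four points,
   which form a positive system of type A3 once sorted, and the sign rule is its
   Jacobi identity. Since two paths with cancelling signs join a to c when there
   is any, d and its transpose square to zero. *)

Require Import Defs.
From HB Require Import structures.
From mathcomp Require Import all_boot all_order all_algebra.
From mathcomp Require Import ring lra zify.

Set Implicit Arguments.
Unset Strict Implicit.
Unset Printing Implicit Defensive.

Import Order.TTheory GRing.Theory Num.Theory.
Local Open Scope ring_scope.

(** * Root systems *)

Section Coordinates.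
Variables (F : realFieldType) (V : vectType F).
Implicit Types u v : V.

Definition coordinate i u : F := coord (vbasis {:V}) i u.

Lemma coordinateD i u v : coordinate i (u + v) = coordinate i u + coordinate i
  v.
Proof. exact: linearD. Qed.

Lemma coordinateN i u : coordinate i (- u) = - coordinate i u.
Proof. exact: linearN. Qed.

Lemma coordinateZ i k u : coordinate i (k *: u) = k * coordinate i u.
Proof. exact: linearZ. Qed.

Lemma coordinate0 i : coordinate i 0 = 0.
Proof. exact: linear0. Qed.

Lemma coordinate_inj u v :
  (forall i, coordinate i u = coordinate i v) -> u = v.
Proof.
move=> uv; rewrite (coord_vbasis (memvf u)) (coord_vbasis (memvf v)).
by apply: eq_bigr => i _; congr (_ *: _); apply: uv.
Qed.

Definition coordinateE := (coordinateD, coordinateN, coordinateZ, coordinate0).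

End Coordinates.

(* Proves an equation of vectors that is a linear combination of equations of
   vectors in the context, by comparing coordinates. *)
Ltac vector :=
  apply: coordinate_inj;
  let i := fresh "i" in move=> i;
  repeat match goal with H : @eq _ ?u ?v |- _ =>
    apply (congr1 (coordinate i)) in H; rewrite ?coordinateE in H end;
  rewrite ?coordinateE; lra.

Section RootSystem.
Variables (F : realFieldType) (V : vectType F) (B : V -> V -> F) (R : seq V).
Hypotheses (BP : inner_product B) (RP : root_system B R).
Implicit Types a b c : V.

Let BC u v : B u v = B v u. Proof. by case: BP. Qed.

Let BDl u v w : B (u + v) w = B u w + B v w.
Proof. by case: BP => _ BL _; rewrite -[u]scale1r BL mul1r scale1r. Qed.

Let B0l w : B 0 w = 0.
Proof. by have := BDl 0 0 w; rewrite addr0; lra. Qed.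

Let BZl k u w : B (k *: u) w = k * B u w.
Proof. by case: BP => _ BL _; rewrite -[k *: u]addr0 BL B0l addr0. Qed.

Let BNl u w : B (- u) w = - B u w.
Proof. by rewrite -scaleN1r BZl mulN1r. Qed.

Let BDr u v w : B w (u + v) = B w u + B w v.
Proof. by rewrite !(BC w) BDl. Qed.

Let BZr k u w : B w (k *: u) = k * B w u.
Proof. by rewrite !(BC w) BZl. Qed.

Let BNr u w : B w (- u) = - B w u.
Proof. by rewrite !(BC w) BNl. Qed.

Let BE := (BDl, BNl, BZl, BDr, BNr, BZr).

Lemma root_neq0 a : a \in R -> a != 0.
Proof. by case: RP => -[_ R0] _ _ _; apply: contraTneq => ->. Qed.

Lemma root_norm_gt0 a : a \in R -> 0 < B a a.
Proof. by case: BP => _ _ pos /root_neq0/pos. Qed.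

Lemma root_reflection a b : a \in R -> b \in R ->
  exists2 m : int, 2 * B b a = m%:~R * B a a & b - m%:~R *: a \in R.
Proof.
case: RP => _ _ refl cart aR bR; have [m mE] := cart _ _ aR bR.
exists m; last by rewrite -mE refl.
by rewrite -mE divfK // gt_eqF // root_norm_gt0.
Qed.

Lemma rootN a : a \in R -> - a \in R.
Proof.
move=> aR; have [m mE] := root_reflection aR aR.
have /(mulIf (lt0r_neq0 (root_norm_gt0 aR))) <- := mE.
by congr (_ \in R); vector.
Qed.

Lemma rootNE a : (- a \in R) = (a \in R).
Proof. by apply/idP/idP => /rootN; rewrite ?opprK. Qed.

Lemma root_double a : a \in R -> a + a \notin R.
Proof.
move=> aR; apply/negP; rewrite -mulr2n -scaler_nat.
by case: RP => _ red _ _ /(red _ _ aR) []; lra.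
Qed.

Lemma rootB a b : a \in R -> b \in R -> 0 < B a b -> a != b -> a - b \in R.
Proof.
move=> aR bR ab neq_ab.
have [m mE mR] := root_reflection aR bR;
  have [n nE nR] := root_reflection bR aR.
have [a0 b0] := (root_norm_gt0 aR, root_norm_gt0 bR).
have [m1|m1] := eqVneq m 1.
  by rewrite -rootNE opprB -[a]scale1r -[1]/(1%:~R) -m1.
have [n1|n1] := eqVneq n 1.
  by rewrite -[b]scale1r -[1]/(1%:~R) -n1.
have ge2 (k : int) (c : F) : 0 < c -> 2 * B a b = k%:~R * c -> k != 1 ->
  c <= B a b.
  move=> c0 kE k1.
  have k0 : (0 : F) < k%:~R by rewrite -(pmulr_lgt0 _ c0) -kE; lra.
  have: 2 <= k by move: k0; rewrite ltr0z; lia.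
  by rewrite -(ler_int F) => k2; nra.
have le1 : B a a <= B a b by apply: ge2 m1 => //; rewrite BC.
have le2 : B b b <= B a b by apply: ge2 n1.
have: 0 < B (a - b) (a - b) by case: BP => _ _; apply; rewrite subr_eq0.
by rewrite !BE (BC b a); lra.
Qed.

Lemma rootD a b : a \in R -> b \in R -> B a b < 0 -> a + b != 0 -> a + b \in R.
Proof.
move=> aR bR ab neq_ab; rewrite -[b]opprK rootB ?rootN //.
  by rewrite BNr oppr_gt0.
by rewrite -subr_eq0 opprK.
Qed.

(* As [(r1 + r2, r3 + r4) = - (r1 + r2, r1 + r2) < 0], one of [r1], [r2] has a
   negative product with one of [r3], [r4]. *)
Lemma root_quadruple r1 r2 r3 r4 :
    [/\ r1 \in R, r2 \in R, r3 \in R & r4 \in R] ->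
    r1 + r2 + r3 + r4 = 0 -> r1 + r3 != 0 -> r1 + r4 != 0 -> r1 + r2 \in R ->
  r1 + r3 \in R \/ r1 + r4 \in R.
Proof.
move=> [R1 R2 R3 R4] sum0 n13 n14 R12.
have e34 : r3 + r4 = - (r1 + r2) by vector.
have e24 : r2 + r4 = - (r1 + r3) by vector.
have e23 : r2 + r3 = - (r1 + r4) by vector.
have := root_norm_gt0 R12; rewrite -[X in B _ X]opprK -e34 BNr !BE => neg.
have [lt13|ge13] := ltP (B r1 r3) 0; first by left; apply: rootD.
have [lt14|ge14] := ltP (B r1 r4) 0; first by right; apply: rootD.
have [lt24|ge24] := ltP (B r2 r4) 0.
  by left; rewrite -rootNE -e24 rootD // e24 oppr_eq0.
have [lt23|ge23] := ltP (B r2 r3) 0.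
  by right; rewrite -rootNE -e23 rootD // e23 oppr_eq0.
by clear sum0 e34 e24 e23; lra.
Qed.

Lemma root_string_ge a b : a \in R -> b \in R ->
  b + a \in R -> b + a + a \notin R -> b + a + a != 0 ->
  - B a a <= 2 * B b a.
Proof.
move=> aR bR baR bbaR nz; rewrite leNgt; apply/negP => lt_ba.
have a0 := root_norm_gt0 aR; have [m mE mR] := root_reflection aR bR.
have m_lt : m < -1.
  by rewrite -(ltr_int F) -(ltr_pM2r a0) -mE; lra.
have [m2|m2] := eqVneq m (- 2%:Z).
  case/negP: bbaR; suff -> : b + a + a = b - m%:~R *: a by [].
  by rewrite m2; vector.
case/negP: bbaR; apply: rootD => //; rewrite BDl.
have: m <= - 3%:Z by lia.
by rewrite -(ler_int F) => m3; nra.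
Qed.

Lemma root_string_lt a b : a \in R -> b \in R ->
  b + a \in R -> b - a \notin R -> b != a -> B b a < 0.
Proof.
move=> aR bR baR nbaR neq_ba; rewrite ltNge; apply/negP => ba0.
have a0 := root_norm_gt0 aR; case/negP: (nbaR).
have [ba_gt0|ba_le0] := ltP 0 (B b a); first exact: rootB.
have [m mE mR] := root_reflection aR baR.
have m2 : m = 2.
  apply/eqP; rewrite -(eqr_int F); apply/eqP/(mulIf (lt0r_neq0 a0)).
  by rewrite -mE BDl (_ : B b a = 0); lra.
suff -> : b - a = b + a - m%:~R *: a by [].
by rewrite m2; vector.
Qed.

(* With [<u, b> := 2 (u, b) / (b, b)], the strings of [z] and [e] give
   [<z, b>, <e, b> >= - 1], so that [<b + z + e, b> >= 0], whereas the string
   of [b + z + e] gives [<b + z + e, b> < 0]. *)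
Lemma root_square (b z e : V) :
    [/\ b \in R, z \in R & e \in R] ->
    [/\ z + b \in R, e + b \in R, b + z + e \in R & b + z + e + b \in R] ->
    z + e \notin R -> z + b + b \notin R -> e + b + b \notin R ->
    [/\ z + e != 0, z + b + b != 0 & e + b + b != 0] ->
  False.
Proof.
move=> [bR zR eR] [zbR ebR bzeR bzebR] ze zbb ebb [nz1 nz2 nz3].
have z_ge := root_string_ge bR zR zbR zbb nz2.
have e_ge := root_string_ge bR eR ebR ebb nz3.
have zeE : b + z + e - b = z + e by vector.
suff: B (b + z + e) b < 0 by clear zeE; rewrite !BE; lra.
by apply: root_string_lt; rewrite // ?zeE // -subr_eq0 zeE.
Qed.

End RootSystem.

(** * Positive systems and structure constants *)

Lemma sort4_ind (T : Type) (lt : rel T) (Pr : T -> T -> T -> T -> Prop) :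
    (forall x y z w, Pr y x z w -> Pr x y z w) ->
    (forall x y z w, Pr x z y w -> Pr x y z w) ->
    (forall x y z w, Pr x y w z -> Pr x y z w) ->
    (forall x y z w, lt x y -> lt y z -> lt z w -> Pr x y z w) ->
  forall x y z w, pairwise (fun u v => lt u v || lt v u) [:: x; y; z; w] ->
    Pr x y z w.
Proof.
move=> s01 s12 s23 sorted_case x y z w /=; rewrite !andbT.
move=> /and3P[/and3P[xy xz xw] /andP[yz yw] zw].
have insert4 u v t r : lt u v -> lt v t -> lt r t || lt t r ->
  lt r v || lt v r ->
    lt r u || lt u r -> Pr u v t r.
  move=> uv vt /orP[rt|]; last by move=> tr _ _; apply: sorted_case.
  case/orP=> [rv|vr _]; last by apply/s23/sorted_case.
  case/orP=> [ru|ur]; last by apply/s23/s12/sorted_case.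
  by apply/s23/s12/s01/sorted_case.
have insert3 u v t r : lt u v -> lt t v || lt v t -> lt t u || lt u t ->
    lt r t || lt t r -> lt r v || lt v r -> lt r u || lt u r -> Pr u v t r.
  move=> uv /orP[tv|vt] + rt rv ru; last by move=> _; apply: insert4.
  case/orP=> [tu|ut]; last by apply/s12/insert4.
  by apply/s12/s01/insert4.
case/orP: xy => [xy|yx]; first by apply: insert3; rewrite // orbC.
by apply/s01/insert3; rewrite // orbC.
Qed.

Section PositiveRoots.
Variables (F : realFieldType) (V : vectType F) (B : V -> V -> F).
Variables (R Rp : seq V).
Hypotheses (BP : inner_product B) (RP : root_system B R).
Hypothesis PP : positive_system R Rp.
Implicit Types u v w : V.

Lemma pos_root u : u \in Rp -> u \in R.
Proof. by case: PP => sub _ _; apply: sub. Qed.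

Lemma posD u v : u \in Rp -> v \in Rp -> u + v \in R -> u + v \in Rp.
Proof. by case: PP => _ _; apply. Qed.

Lemma posN u : u \in Rp -> - u \notin Rp.
Proof.
by move=> uP; case: PP => _ /(_ _ (pos_root uP)) + _; rewrite uP.
Qed.

Lemma pos_or_neg u : u \in R -> u \in Rp \/ - u \in Rp.
Proof. by case: PP => _ + _ => /[apply]; case: (u \in Rp); [left|right]. Qed.

Lemma pos_neq0 u : u \in Rp -> u != 0.
Proof. by move=> /pos_root/(root_neq0 RP). Qed.

Lemma pos_sum2 u v : u \in Rp -> v \in Rp -> u + v != 0.
Proof.
move=> uP vP; apply/eqP => uv; have /negP[] := posN uP.
by rewrite (_ : - u = v) //; vector.
Qed.

Lemma pos_sum3 u v w : u \in Rp -> v \in Rp -> w \in Rp -> u + v + w != 0.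
Proof.
move=> uP vP wP; apply/eqP => uvw; have /negP[] := posN wP.
have wE : - w = u + v by vector.
by rewrite wE posD // -wE; apply/(rootN BP RP)/pos_root.
Qed.

Lemma pos_double u : u \in Rp -> u + u \notin Rp.
Proof. by move=> uP; apply: contra (root_double RP (pos_root uP));
  apply: pos_root. Qed.

Local Notation P := (seq_sub Rp).

Lemma posP (x : P) : val x \in Rp. Proof. exact: ssvalP. Qed.

Lemma pos_rootP (x : P) : val x \in R. Proof. exact/pos_root/posP. Qed.

Lemma pos_val u : u \in Rp -> exists x : P, u = val x.
Proof. by move=> uP; exists (SeqSub uP). Qed.

Variable br : {ffun P -> int} -> {ffun P -> int} -> {ffun P -> int}.
Hypothesis brP : root_bracket br.
Implicit Types (x y z : P) (f g : {ffun P -> int}).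

Definition structure_constant x y z : int := br (zbasis x) (zbasis y) z.
Local Notation c := structure_constant.

Let brBr f : zmod_morphism (br f). Proof. by case: brP => -[]. Qed.

Let brMr f g (k : int) : br f (g *~ k) = br f g *~ k.
Proof.
pose M := GRing.isZmodMorphism.Build _ _ _ (brBr f).
pose G : {additive {ffun P -> int} -> {ffun P -> int}} := HB.pack (br f) M.
exact: (raddfMz G).
Qed.

Lemma bracketC f g : br f g = - br g f.
Proof.
case: brP => -[_ brBl br0 _] _ _; apply/eqP; rewrite -subr_eq0 opprK.
have := br0 (f - g); rewrite brBl !brBr !br0 sub0r subr0.
by move/eqP; rewrite -opprD oppr_eq0 addrC.
Qed.

Lemma structure_constantC x y z : c y x z = - c x y z.
Proof. by rewrite /c bracketC ffunE. Qed.

Lemma structure_constant_eq0 x y z : val z <> val x + val y -> c x y z = 0.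
Proof.
case: brP => _ br1 br0;
  have [/pos_val[t tE] zE|xyN _] := boolP (val x + val y \in Rp).
  have tz : z == t = false by apply/eqP => zt; apply: zE; rewrite tE zt.
  by rewrite /c; case: (br1 x y t) => // ->; rewrite !ffunE tz.
by rewrite /c br0 // ffunE.
Qed.

Lemma structure_constant_sign x y z :
  val z = val x + val y -> c x y z = 1 \/ c x y z = -1.
Proof.
case: brP => _ br1 _ /br1; rewrite /c.
by case=> ->; rewrite !ffunE eqxx; [left|right].
Qed.

Lemma bracket_basis x y z :
  val z = val x + val y -> br (zbasis x) (zbasis y) = zbasis z *~ c x y z.
Proof.
case: brP => _ br1 _ /br1; rewrite /c.
by case=> ->; rewrite !ffunE eqxx ?mulrNz.
Qed.

Lemma double_bracket x y z p t : val p = val y + val z ->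
  val t = val x + val p ->
  br (zbasis x) (br (zbasis y) (zbasis z)) t = c y z p * c x p t.
Proof.
move=> pE tE; rewrite (bracket_basis pE) brMr (bracket_basis tE) !ffunMzE ffunE.
by rewrite eqxx !mulrzz mul1r mulrC.
Qed.

Lemma structure_constant_jacobi x y z p q t :
    val p = val x + val y -> val q = val y + val z ->
    val t = val x + val y + val z ->
  val x + val z \notin Rp /\ c x y p * c p z t = c y z q * c x q t.
Proof.
move=> pE qE tE; case: (brP) => -[_ _ _ jac] _ br0.
have := congr1 (fun u : {ffun P ->
  int} => u t) (jac (zbasis x) (zbasis y) (zbasis z)).
rewrite !ffunE (@double_bracket x y z q t) ?qE ?tE ?addrA //.
rewrite (@double_bracket z x y p t) ?pE ?tE //; last by vector.
rewrite (structure_constantC p z).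
have [/pos_val[r rE]|xzN] := boolP (val x + val z \in Rp).
  have rE' : val r = val z + val x by vector.
  have tE' : val t = val y + val r by vector.
  have yqt : val t = val x + val q by vector.
  have pzt : val t = val p + val z by vector.
  rewrite (@double_bracket y z x r t) //.
  have [] := structure_constant_sign rE';
    have [] := structure_constant_sign tE';
  have [] := structure_constant_sign yqt;
    have [] := structure_constant_sign pzt;
  have [] := structure_constant_sign pE; have [] := structure_constant_sign qE;
  by do 6 move->.
rewrite (br0 z x); last by rewrite addrC.
have -> : br (zbasis y) 0 = 0 by rewrite -(mulr0z 0) brMr mulr0z.
by rewrite ffunE => eq0; split=> //; lia.
Qed.

Lemma pos_jacobi u v w : [/\ u \in Rp, v \in Rp & w \in Rp] ->
  u + v \in R -> v + w \in R -> u + v + w \in R -> u + w \notin R.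
Proof.
move=> [/pos_val[x ->] /pos_val[y ->] /pos_val[z ->]].
move=> /(posD (posP x) (posP y)) xyP; case/pos_val: (xyP) => p pE.
move=> /(posD (posP y) (posP z))/pos_val[q qE].
move=> /(posD xyP (posP z))/pos_val[t tE].
have [xzN _] := structure_constant_jacobi (esym pE) (esym qE) (esym tE).
by apply: contra xzN => /posD; apply; apply: posP.
Qed.

Lemma pos_square u v w : [/\ u \in Rp, v \in Rp & w \in Rp] ->
  [/\ v + u \in R, w + u \in R, u + v + w \in R & u + v + w + u \in R] -> False.
Proof.
move=> [uP vP wP] [vuR wuR uvwR uvwuR].
have vuP := posD vP uP vuR; have wuP := posD wP uP wuR.
have e1 : v + u + w = u + v + w by vector.
have e2 : w + u + v = u + v + w by vector.
have e3 : u + v + (w + u) = u + v + w + u by vector.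
have e4 : u + w + (v + u) = u + v + w + u by vector.
have e5 : v + (w + u) = u + v + w by vector.
have e6 : w + (v + u) = u + v + w by vector.
apply: (@root_square _ _ _ _ BP RP u v w).
- by split; apply: pos_root.
- by split.
- by apply: (@pos_jacobi v u w); rewrite // (e1, addrC).
- by apply: (@pos_jacobi (v + u) w u); rewrite // e1.
- by apply: (@pos_jacobi (w + u) v u); rewrite // e2.
- by split; [apply: pos_sum2 | apply: pos_sum3 | apply: pos_sum3].
Qed.

Let cmp u v := v - u \in R.
Let lt u v := v - u \in Rp.
Let nroot u v w t := u + v - w - t \notin R.

Let cmpC u v : cmp u v = cmp v u.
Proof. by rewrite /cmp -(rootNE BP RP) opprB. Qed.

Let cmp_lt u v : cmp u v -> lt u v || lt v u.
Proof. by move=> /pos_or_neg[]; rewrite /lt ?opprB => ->; rewrite ?orbT. Qed.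

Let nroot_swap u v w t : nroot u v w t = nroot v u w t.
Proof. by rewrite /nroot (addrC u). Qed.

Let nroot_swap' u v w t : nroot u v w t = nroot u v t w.
Proof. by rewrite /nroot addrAC. Qed.

Let nrootC u v w t : nroot u v w t = nroot w t u v.
Proof.
by rewrite /nroot -(rootNE BP RP); congr (_ \notin R); vector.
Qed.

(* Four points with all differences roots form, once sorted, the positive
   system of type A3 given by the successive differences [a], [b], [c]. The
   remaining combinations are [a + c], excluded by the Jacobi identity, and
   [a + 2 b + c], [a - c], excluded by [pos_square]. *)
Lemma four_points_nonroot u v w t :
    pairwise (fun x y : V => y - x \in R) [:: u; v; w; t] ->
  [/\ u + v - w - t \notin R, u + w - v - t \notin R & u + t - v - w \notin R].
Proof.
pose Pr u v w t := pairwise cmp [:: u; v; w; t] ->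
  [/\ nroot u v w t, nroot u w v t & nroot u t v w].
move=> uvwt; apply: (@sort4_ind _ lt Pr) (uvwt) => //.
- rewrite /Pr /= => {uvwt}x y z s h.
  rewrite !andbT => /and3P[/and3P[h1 h2 h3] /andP[h4 h5] h6].
  case: h => [|n1 n2 n3].
    by rewrite cmpC h1 h2 h3 h4 h5 h6.
  by split; [rewrite nroot_swap | rewrite nrootC | rewrite nrootC].
- rewrite /Pr /= => {uvwt}x y z s h.
  rewrite !andbT => /and3P[/and3P[h1 h2 h3] /andP[h4 h5] h6].
  case: h => [|n1 n2 n3].
    by rewrite [cmp z y]cmpC h1 h2 h3 h4 h5 h6.
  by split; rewrite // nroot_swap'.
- rewrite /Pr /= => {uvwt}x y z s h.
  rewrite !andbT => /and3P[/and3P[h1 h2 h3] /andP[h4 h5] h6].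
  case: h => [|n1 n2 n3].
    by rewrite [cmp s z]cmpC h1 h2 h3 h4 h5 h6.
  by split; rewrite // nroot_swap'.
- rewrite /Pr => {uvwt}x y z s xy yz zs /=; rewrite !andbT.
  move=> /and3P[/and3P[_ xz xs] /andP[_ ys] _]; split.
  + apply/negP => n1.
    apply: (@pos_square (z - y) (y - x) (s - z)); split=> //.
    * by rewrite (_ : _ + _ = z - x) //; vector.
    * by rewrite (_ : _ + _ = s - y) //; vector.
    * by rewrite (_ : _ + _ = s - x) //; vector.
    * by rewrite -(rootNE BP RP) (_ : - _ = x + y - z - s) //; vector.
  + rewrite /nroot -(rootNE BP RP) (_ : - _ = (y - x) + (s - z));
    last by vector.
    apply: (@pos_jacobi _ (z - y) _) => //.
    * by rewrite (_ : _ + _ = z - x) //; vector.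
    * by rewrite (_ : _ + _ = s - y) //; vector.
    * by rewrite (_ : _ + _ = s - x) //; vector.
  + apply/negP => /pos_or_neg[] n3.
    * apply: (@pos_square (y - x) (x + s - y - z) (z - y)); split=> //.
      - by rewrite (_ : _ + _ = s - z) ?pos_root //; vector.
      - by rewrite (_ : _ + _ = z - x) //; vector.
      - by rewrite (_ : _ + _ = s - y) //; vector.
      - by rewrite (_ : _ + _ = s - x) //; vector.
    * apply: (@pos_square (s - z) (- (x + s - y - z)) (z - y)); split=> //.
      - by rewrite (_ : _ + _ = y - x) ?pos_root //; vector.
      - by rewrite (_ : _ + _ = s - y) //; vector.
      - by rewrite (_ : _ + _ = z - x) //; vector.
      - by rewrite (_ : _ + _ = s - x) //; vector.
- move: uvwt; rewrite /= !andbT => /and3P[/and3P[h1 h2 h3] /andP[h4 h5] h6].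
  by rewrite !cmp_lt.
Qed.

Definition triple_constant x y z : int := c x y z + c y z x + c z x y.
Local Notation K := triple_constant.

Lemma triple_constant_rot x y z : K y z x = K x y z.
Proof. by rewrite /K; ring. Qed.

Lemma triple_constant_swap x y z : K x z y = - K x y z.
Proof.
rewrite /K (structure_constantC z y) (structure_constantC x z).
by rewrite (structure_constantC y x); ring.
Qed.

Lemma triple_constantE x y z : val z = val x + val y -> K x y z = c x y z.
Proof.
move=> zE; rewrite /K (@structure_constant_eq0 y z) ?(@structure_constant_eq0 z
  x).
- by rewrite !addr0.
- by move=> yE; have /eqP[] := pos_neq0 (posP x); vector.
- by move=> xE; have /eqP[] := pos_neq0 (posP y); vector.
Qed.

Let pm x u := val x = u \/ val x = - u.

Let pm_opp x u u' : u' = - u -> pm x u -> pm x u'.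
Proof. by move=> ->; rewrite /pm opprK; case; [right|left]. Qed.

Let pm_pos x u : u \in Rp -> pm x u -> val x = u.
Proof.
by move=> uP [//|xE]; have := posN uP; rewrite -xE posP.
Qed.

Lemma four_points_constants u v w t (uv uw ut vw vt wt : P) :
    pairwise (fun x y : V => y - x \in R) [:: u; v; w; t] ->
    [/\ pm uv (v - u), pm uw (w - u) & pm ut (t - u)] ->
    [/\ pm vw (w - v), pm vt (t - v) & pm wt (t - w)] ->
  K uv vw uw * K uw wt ut * K uv vt ut * K vw wt vt = 1.
Proof.
pose Pr u v w t := forall uv uw ut vw vt wt : P,
    [/\ pm uv (v - u), pm uw (w - u) & pm ut (t - u)] ->
    [/\ pm vw (w - v), pm vt (t - v) & pm wt (t - w)] ->
  K uv vw uw * K uw wt ut * K uv vt ut * K vw wt vt = 1.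
move=> uvwt; apply: (@sort4_ind _ lt Pr).
- move=> {u v w t uvwt uv uw ut vw vt wt} u v w t h.
  move=> uv uw ut vw vt wt [h1 h2 h3] [h4 h5 h6].
  rewrite -(h uv vw vt uw ut wt); first last.
  + by split.
  + by split=> //; apply: pm_opp h1; rewrite opprB.
  by rewrite (triple_constant_swap uv uw) (triple_constant_swap uv ut); ring.
- move=> {u v w t uvwt uv uw ut vw vt wt} u v w t h.
  move=> uv uw ut vw vt wt [h1 h2 h3] [h4 h5 h6].
  rewrite -(h uw uv ut vw wt vt); first last.
  + by split=> //; apply: pm_opp h4; rewrite opprB.
  + by split.
  rewrite (triple_constant_rot uv uw vw) (triple_constant_swap uv vw uw).
  by rewrite (triple_constant_swap vw wt vt); ring.
- move=> {u v w t uvwt uv uw ut vw vt wt} u v w t h.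
  move=> uv uw ut vw vt wt [h1 h2 h3] [h4 h5 h6].
  rewrite -(h uv ut uw vt vw wt); first last.
  + by split=> //; apply: pm_opp h6; rewrite opprB.
  + by split.
  rewrite (triple_constant_rot uw ut wt) (triple_constant_swap uw wt ut).
  by rewrite (triple_constant_rot vw vt wt) (triple_constant_swap vw wt vt);
    ring.
- move=> {u v w t uvwt uv uw ut vw vt wt} u v w t uv_lt vw_lt wt_lt.
  move=> uv uw ut vw vt wt [h1 h2 h3] [h4 h5 h6].
  have uvE := pm_pos uv_lt h1; have vwE := pm_pos vw_lt h4.
  have wtE := pm_pos wt_lt h6.
  have sumE x y z (r : V) : val x + val y = r -> pm z r ->
    val z = val x + val y.
    move=> <- [//|zE]; have := pos_sum3 (posP x) (posP y) (posP z).
    by rewrite zE addrN eqxx.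
  have uwE : val uw = val uv + val vw by apply: sumE h2; vector.
  have vtE : val vt = val vw + val wt by apply: sumE h5; vector.
  have utE : val ut = val uw + val wt by apply: sumE h3; vector.
  have utE' : val ut = val uv + val vt by vector.
  have utE'' : val ut = val uv + val vw + val wt by vector.
  have [_ jac] := structure_constant_jacobi uwE vtE utE''.
  rewrite !triple_constantE // jac.
  by have [] := structure_constant_sign vtE;
    have [] := structure_constant_sign utE' => -> ->.
- move: uvwt; rewrite /= !andbT => /and3P[/and3P[h1 h2 h3] /andP[h4 h5] h6].
  by rewrite !cmp_lt.
Qed.

End PositiveRoots.

(** * Symmetric differences and signs of flips *)

Section SymmetricDifference.
Variable T : finType.
Implicit Types a b s t : {set T}.

Definition symdiff a b : {set T} := (a :\: b) :|: (b :\: a).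

Lemma in_symdiff x a b : (x \in symdiff a b) = (x \in a) (+) (x \in b).
Proof. by rewrite !inE; case: (x \in a); case: (x \in b). Qed.

Lemma symdiffC a b : symdiff a b = symdiff b a.
Proof. by apply/setP => x; rewrite !in_symdiff addbC. Qed.

Lemma symdiffA a b s : symdiff a (symdiff b s) = symdiff (symdiff a b) s.
Proof. by apply/setP => x; rewrite !in_symdiff addbA. Qed.

Lemma symdiffK a b : symdiff a (symdiff a b) = b.
Proof. by apply/setP => x; rewrite !in_symdiff addKb. Qed.

Lemma symdiffvv a : symdiff a a = set0.
Proof. by apply/setP => x; rewrite in_symdiff addbb inE. Qed.

Lemma symdiff_inj a : injective (symdiff a).
Proof. exact: can_inj (symdiffK a). Qed.

Lemma symdiff_path a s s' t t' : symdiff s t = symdiff s' t' ->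
  symdiff (symdiff a s') (symdiff (symdiff a s) t) = t'.
Proof. by move=> E; rewrite -(symdiffA a s) E (symdiffA a s' t') symdiffK. Qed.

Lemma card_symdiff a b : (#|symdiff a b| + #|a :&: b|.*2 = #|a| + #|b|)%N.
Proof.
have ab_disj : [disjoint a :\: b & b :\: a].
  rewrite -setI_eq0; apply/eqP/setP => x; rewrite !inE.
  by case: (x \in a); case: (x \in b).
rewrite /symdiff cardsU (disjoint_setI0 ab_disj) cards0 subn0.
by rewrite -(cardsID b a) -(cardsID a b) [b :&: a]setIC; lia.
Qed.

End SymmetricDifference.

(* [flip_sign a w] is the coefficient of [flips a w] in the image of the basis
   element [a] of the exterior algebra under the successive letters [x] of [w],
   [x] acting as the sum of the exterior multiplication by [x] and of its
   transpose: these operators anticommute and are involutive. *)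
Section Flips.
Variables (T : finType) (le : rel T).
Hypothesis leP : total_order le.
Implicit Types (a b s : {set T}) (x y z : T) (w : seq T).

Definition flip a x := symdiff a [set x].

Definition flips a w := foldl flip a w.

Definition before_sign a x : int := \prod_(y in a) (-1) ^+ ~~ le x y.

Fixpoint flip_sign a w : int :=
  if w is x :: w' then before_sign a x * flip_sign (flip a x) w' else 1.

Lemma in_flips y a w : (y \in flips a w) = (y \in a) (+) odd (count_mem y w).
Proof.
elim: w a => [|x w IH] a /=; first by rewrite addbF.
by rewrite IH in_symdiff inE oddD eq_sym -addbA; case: eqP.
Qed.

Lemma before_sign_flip a x y :
  before_sign (flip a x) y = before_sign a y * (-1) ^+ ~~ le y x.
Proof.
have [xa|xa] := boolP (x \in a).
  have -> : flip a x = a :\ x.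
    apply/setP => z; rewrite in_symdiff !inE.
    by case: eqP => [->|_]; rewrite ?xa // addbF.
  rewrite /before_sign [in RHS](big_setD1 x) //= mulrAC -signr_addb addbb.
  by rewrite mul1r.
have -> : flip a x = x |: a.
  by apply/setP => z; rewrite in_symdiff !inE; case: eqP => [->|_];
    rewrite ?(negPf xa) ?addbF.
by rewrite /before_sign big_setU1 //= mulrC.
Qed.

Lemma before_sign_sqr a x : before_sign a x * before_sign a x = 1.
Proof.
rewrite /before_sign -big_split /= big1 // => y _.
by rewrite -signr_addb addbb.
Qed.

Lemma flip_sign_cat a w w' :
  flip_sign a (w ++ w') = flip_sign a w * flip_sign (flips a w) w'.
Proof.
elim: w a => [|x w IH] a; first by rewrite mul1r.
by rewrite /= IH mulrA.
Qed.

Lemma flipC a x y : flip (flip a x) y = flip (flip a y) x.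
Proof. by rewrite /flip -!symdiffA [symdiff [set x] _]symdiffC. Qed.

Lemma flip_signC a x y w : x != y ->
  flip_sign a [:: x, y & w] = - flip_sign a [:: y, x & w].
Proof.
case: leP => _ anti _ tot xy /=; rewrite !before_sign_flip (flipC a x y).
have := tot x y; case lexy: (le x y); case leyx: (le y x) => //= _;
  last 2 first.
- by rewrite expr1 expr0; ring.
- by rewrite expr1 expr0; ring.
by case/eqP: xy; apply: anti; rewrite lexy leyx.
Qed.

Lemma flip_signK a x w : flip_sign a [:: x, x & w] = flip_sign a w.
Proof.
case: leP => refl _ _ _ /=; rewrite before_sign_flip refl expr0 mulr1 mulrA.
rewrite before_sign_sqr mul1r /flip -symdiffA symdiffvv; congr flip_sign.
by apply/setP => y; rewrite in_symdiff inE addbF.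
Qed.

Lemma flip_sign_catC2 a u x y w : x != y ->
  flip_sign a (u ++ [:: x, y & w]) = - flip_sign a (u ++ [:: y, x & w]).
Proof. by move=> xy; rewrite !flip_sign_cat flip_signC // mulrN. Qed.

Lemma flip_sign_catK a u x w :
  flip_sign a (u ++ [:: x, x & w]) = flip_sign a (u ++ w).
Proof. by rewrite !flip_sign_cat flip_signK. Qed.

Lemma flip_sign_move a x w w' : x \notin w ->
  flip_sign a (x :: w ++ w') = (-1) ^+ size w * flip_sign a (w ++ x :: w').
Proof.
elim: w a => [|y w IH] a; first by rewrite mul1r.
rewrite inE negb_or => /andP[xy xw]; rewrite flip_signC // /= exprS.
by have /= -> := IH (flip a y) xw; ring.
Qed.

Lemma flip_sign_sqr a w : flip_sign a w * flip_sign a w = 1.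
Proof.
elim: w a => [|x w IH] a //=.
by rewrite mulrACA before_sign_sqr IH.
Qed.

Lemma flip_sign_catC a w w' : {in w, forall x, x \notin w'} ->
  flip_sign a (w ++ w') = (-1) ^+ (size w * size w') * flip_sign a (w' ++ w).
Proof.
elim: w a w' => [|x w IH] a w' dis; first by rewrite cats0 mul1r.
have xw' : x \notin w' by apply: dis; rewrite mem_head.
have {}dis : {in w, forall y, y \notin w'}.
  by move=> y yw; apply: dis; rewrite inE yw orbT.
have -> : flip_sign a ((x :: w) ++ w') =
    (-1) ^+ (size w * size w') * flip_sign a (x :: w' ++ w).
  by rewrite /= IH //; ring.
by rewrite flip_sign_move // mulrA -exprD mulSn addnC.
Qed.

Lemma flip_sign_triple a x y z : uniq [:: x; y; z] ->
  flip_sign (flips a [:: x; y; z]) [:: x; y; z] = - flip_sign a [:: x; y; z].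
Proof.
rewrite /= !inE negb_or andbT => /andP[/andP[xy xz] yz].
have := flip_sign_cat a [:: x; y; z] [:: x; y; z].
rewrite (@flip_sign_catC2 a [:: x; y] z x [:: y; z]) 1?eq_sym //.
rewrite (@flip_sign_catC2 a [:: x] y x [:: z; y; z]) 1?eq_sym // opprK.
rewrite (@flip_sign_catK a [::] x) (@flip_sign_catC2 a [:: y] z y) 1?eq_sym //.
rewrite (@flip_sign_catK a [::] y) (@flip_sign_catK a [::] z) /= => eq1.
have := flip_sign_sqr a [:: x; y; z]; have := flip_sign_sqr (flips a [:: x; y;
  z]) [:: x; y; z].
move: eq1 => /=; set s := before_sign _ _ * _; set t := before_sign _ _ * _.
by nia.
Qed.

End Flips.

(** * The basis graph *)

Section Triples.
Variable T : finType.
Implicit Types (A D : {set T}) (x y z : T).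

Lemma cards3P A : #|A| = 3%N ->
  exists x y z, uniq [:: x; y; z] /\ A = [set x; y; z].
Proof.
move=> A3; have [x xA] : exists x, x \in A by apply/set0Pn;
  rewrite -card_gt0 A3.
have /cards2P[y [z [yz AE]]] : #|A :\ x| == 2%N by move: A3;
  rewrite (cardsD1 x) xA add1n => -[->].
exists x, y, z; split; last by rewrite -setUA -AE setD1K.
have: x \notin A :\ x by rewrite !inE eqxx.
by rewrite AE /= !inE yz andbT => ->.
Qed.

Lemma cards3 x y z : uniq [:: x; y; z] -> #|[set x; y; z]| = 3%N.
Proof.
move=> u; rewrite -[3%N]/(size [:: x; y; z]) -(card_uniqP u).
by apply: eq_card => t; rewrite !inE orbA.
Qed.

Lemma big_set3 (A : nmodType) (f : T -> A) x y z : uniq [:: x; y; z] ->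
  \sum_(t in [set x; y; z]) f t = f x + f y + f z.
Proof.
move=> u; rewrite [RHS](_ : _ = \sum_(t <- [:: x; y; z]) f t).
  by rewrite [RHS]big_uniq //=; apply: eq_bigl => t; rewrite !inE orbA.
by rewrite !big_cons big_nil addr0 addrA.
Qed.

Lemma symdiff_flips A x y z : uniq [:: x; y; z] ->
  symdiff A [set x; y; z] = flips A [:: x; y; z].
Proof.
case/andP=> + /andP[+ _]; rewrite !inE negb_or => /andP[xy xz] yz.
apply/setP => t; rewrite in_symdiff in_flips !inE /=; congr (_ (+) _).
rewrite ![_ == t]eq_sym; have [tx|tx] := eqVneq t x; last first.
  by case: (eqVneq t y) => [->|_]; [rewrite (negPf yz) | case: (t == z)].
by rewrite tx (negPf xy) (negPf xz).
Qed.

Lemma card_symdiff3 A x y z : uniq [:: x; y; z] ->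
    (y \in A) = (x \in A) -> (z \in A) = (x \notin A) ->
  if x \in A then #|A| = #|symdiff A [set x; y; z]|.+1
  else #|symdiff A [set x; y; z]| = #|A|.+1.
Proof.
move=> u yA zA; have := card_symdiff A [set x; y; z]; rewrite cards3 //.
have [xA|xA] := boolP (x \in A); rewrite ?xA ?(negPf xA) in yA zA.
  have -> : A :&: [set x; y; z] = [set x; y].
    apply/setP => t; rewrite !inE andbC.
    case: (eqVneq t x) => [->|_]; first by rewrite xA.
    case: (eqVneq t y) => [->|_]; first by rewrite yA.
    by case: eqP => [->|_]; rewrite ?zA.
  have xy : x != y by case/andP: u; rewrite !inE negb_or => /andP[].
  by rewrite cards2 xy; lia.
have -> : A :&: [set x; y; z] = [set z].
  apply/setP => t; rewrite !inE.
  case: (eqVneq t z) => [->|_]; first by rewrite zA !orbT.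
  rewrite orbF; case: eqP => [->|_]; first by rewrite (negPf xA).
  by case: eqP => [->|_]; rewrite ?yA ?andbF.
by rewrite cards1; lia.
Qed.

Lemma uniq5_swap34 (x1 x2 x3 x4 x5 : T) :
  uniq [:: x1; x2; x3; x4; x5] = uniq [:: x1; x2; x4; x3; x5].
Proof. by apply: perm_uniq; apply/permP => p /=; lia. Qed.

Lemma uniq5_swap12_34 (x1 x2 x3 x4 x5 : T) :
  uniq [:: x1; x2; x3; x4; x5] = uniq [:: x2; x1; x4; x3; x5].
Proof. by apply: perm_uniq; apply/permP => p /=; lia. Qed.

End Triples.

Section RootGraph.
Variables (F : realFieldType) (V : vectType F) (B : V -> V -> F).
Variables (R Rp : seq V).
Hypotheses (BP : inner_product B) (RP : root_system B R).
Hypothesis PP : positive_system R Rp.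
Local Notation P := (seq_sub Rp).
Implicit Types (a b c D : {set P}) (x y z e : P).

Definition signed_root a x : V := if x \in a then val x else - val x.
Local Notation sg := signed_root.

Definition zero_sum a D := (#|D| == 3%N) && (\sum_(x in D) sg a x == 0).

Lemma signed_rootP a x : sg a x \in R.
Proof.
by rewrite /sg; case: ifP; rewrite ?(rootNE BP RP) (pos_rootP PP).
Qed.

Lemma signed_root_symdiff a D x :
  sg (symdiff a D) x = if x \in D then - sg a x else sg a x.
Proof.
by rewrite /sg in_symdiff; case: (x \in a); case: (x \in D); rewrite ?opprK.
Qed.

Lemma signed_rootN a x y : sg a x <> - sg a y.
Proof.
have := pos_sum2 PP (posP x) (posP y); rewrite /sg.
case xa: (x \in a); case ya: (y \in a); rewrite ?opprK => /eqP h e.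
- by apply: h; vector.
- by move: (val_inj e) ya => <-; rewrite xa.
- by move: (val_inj (oppr_inj e)) ya => <-; rewrite xa.
- by apply: h; vector.
Qed.

Lemma signed_root_inj a : injective (sg a).
Proof.
move=> x y; have := pos_sum2 PP (posP x) (posP y); rewrite /sg.
case: (x \in a); case: (y \in a) => /eqP h e.
- exact: val_inj.
- by case: h; vector.
- by case: h; vector.
- exact: (val_inj (oppr_inj e)).
Qed.

Lemma root_signed_root a (u : V) : u \in R ->
  exists x, sg a x = u \/ sg a x = - u.
Proof.
by move=> /(pos_or_neg PP)[] /pos_val[x e]; exists x; rewrite /sg -?e;
  case: ifP => _; rewrite ?opprK; [left|right|right|left].
Qed.

Lemma zero_sum3 a x y z : uniq [:: x; y; z] ->
  zero_sum a [set x; y; z] = (sg a x + sg a y + sg a z == 0).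
Proof. by move=> u; rewrite /zero_sum cards3 // big_set3. Qed.

Lemma zero_sumP a D : zero_sum a D -> exists e e1 e2,
  [/\ uniq [:: e1; e2; e], D = [set e1; e2; e], val e = val e1 + val e2,
      (e2 \in a) = (e1 \in a) & (e \in a) = ~~ (e1 \in a)].
Proof.
case/andP=> /eqP D3 /eqP; have [x [y [z [u DE]]]] := cards3P D3.
rewrite DE big_set3 // /sg.
have := pos_sum3 BP RP PP (posP x) (posP y) (posP z).
have uniq_rot e e1 e2 : uniq [:: e; e1; e2] -> uniq [:: e1; e2; e].
  by rewrite -(rot_uniq 1).
have set_rot e e1 e2 : [set e; e1; e2] = [set e1; e2; e].
  by apply/setP => t; rewrite !inE orbAC orbC orbA orbAC.
case xa: (x \in a); case ya: (y \in a); case za: (z \in a) => /eqP h e.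
- by case: h.
- exists z, x, y; split; rewrite ?xa ?ya ?za //; vector.
- exists y, z, x; split; rewrite ?xa ?ya ?za //; first exact/uniq_rot/uniq_rot.
  by vector.
- exists x, y, z; split; rewrite ?xa ?ya ?za //; first exact/uniq_rot.
  by vector.
- exists x, y, z; split; rewrite ?xa ?ya ?za //; first exact/uniq_rot.
  by vector.
- exists y, z, x; split; rewrite ?xa ?ya ?za //; first exact/uniq_rot/uniq_rot.
  by vector.
- exists z, x, y; split; rewrite ?xa ?ya ?za //; vector.
- by case: h; vector.
Qed.

Lemma root_graphE a b : root_graph Rp a b = zero_sum a (symdiff a b).
Proof.
have uniqE e e1 e2 : val e = val e1 + val e2 -> uniq [:: e1; e2; e].
  move=> eE; rewrite /= !inE negb_or andbT; apply/andP; split; last first.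
    apply/eqP => e2e; have /eqP[] := pos_neq0 RP PP (posP e1).
    by rewrite e2e in eE *; vector.
  apply/andP; split; apply/eqP => e1E.
    by have := pos_double RP PP (posP e1); rewrite {2}e1E -eE posP.
  have /eqP[] := pos_neq0 RP PP (posP e2).
  by rewrite e1E in eE *; vector.
apply/existsP/idP => [[e /existsP[e1 /existsP[e2]]]|].
  move=> /andP[/eqP eE] /orP[] /andP[/eqP h1 /eqP h2].
    have -> : symdiff a b = [set e1; e2; e] by rewrite /symdiff h1 h2 setUC.
    rewrite zero_sum3 ?uniqE // /sg.
    have : e \in a :\: b by rewrite h1 inE.
    have : e1 \in b :\: a by rewrite h2 !inE eqxx.
    have : e2 \in b :\: a by rewrite h2 !inE eqxx orbT.
    rewrite !inE => /andP[/negPf -> _] /andP[/negPf -> _] /andP[_ ->].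
    by apply/eqP; vector.
  have -> : symdiff a b = [set e1; e2; e] by rewrite /symdiff h1 h2.
  rewrite zero_sum3 ?uniqE // /sg.
  have : e \in b :\: a by rewrite h1 inE.
  have : e1 \in a :\: b by rewrite h2 !inE eqxx.
  have : e2 \in a :\: b by rewrite h2 !inE eqxx orbT.
  rewrite !inE => /andP[_ ->] /andP[_ ->] /andP[/negPf -> _].
  by apply/eqP; vector.
move=> /zero_sumP[e [e1 [e2 [u abE eE e2a ea]]]].
exists e; apply/existsP; exists e1; apply/existsP; exists e2;
  rewrite eE eqxx /=.
have inD t : (t \in symdiff a b) = [|| t == e1, t == e2 | t == e].
  by rewrite abE !inE orbA.
have abI : a :\: b = symdiff a b :&: a.
  by apply/setP => t; rewrite inE in_setI in_symdiff; case: (t \in a);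
    case: (t \in b).
have baI : b :\: a = symdiff a b :\: a.
  by apply/setP => t; rewrite inE in_setD in_symdiff; case: (t \in a);
    case: (t \in b).
case e1a: (e1 \in a) in e2a ea; apply/orP; [right|left]; apply/andP; split;
  apply/eqP/setP => t.
- rewrite baI in_setD inD !inE; case: (eqVneq t e) => [->|_];
  first by rewrite ea !orbT.
  by rewrite orbF; case: eqP => [->|_]; rewrite ?e1a //; case: eqP => [->|_];
    rewrite ?e2a ?andbF.
- rewrite abI in_setI inD !inE; case: (eqVneq t e1) => [->|_];
  first by rewrite e1a.
  case: (eqVneq t e2) => [->|_]; first by rewrite e2a.
  by case: eqP => [->|_]; rewrite ?ea.
- rewrite abI in_setI inD !inE; case: (eqVneq t e) => [->|_];
  first by rewrite ea !orbT.
  by rewrite orbF; case: eqP => [->|_]; rewrite ?e1a //; case: eqP => [->|_];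
    rewrite ?e2a.
- rewrite baI in_setD inD !inE; case: (eqVneq t e1) => [->|_];
  first by rewrite e1a.
  case: (eqVneq t e2) => [->|_]; first by rewrite e2a.
  by case: eqP => [->|_]; rewrite ?ea ?andbF.
Qed.

Lemma zero_sum_symdiffK a D : zero_sum (symdiff a D) D = zero_sum a D.
Proof.
rewrite /zero_sum (eq_bigr (fun x => - sg a x)) => [|x xD].
  by rewrite sumrN oppr_eq0.
by rewrite signed_root_symdiff xD.
Qed.

Lemma sum_symdiff a D D' : \sum_(x in D') sg (symdiff a D) x =
  \sum_(x in D' :\: D) sg a x - \sum_(x in D' :&: D) sg a x.
Proof.
rewrite (big_setID D) /= addrC -sumrN; congr (_ + _); apply: eq_bigr => x.
  by rewrite inE signed_root_symdiff => /andP[/negPf ->].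
by rewrite inE signed_root_symdiff => /andP[_ ->].
Qed.

Lemma zero_sum_disjoint a D D' : D :&: D' = set0 ->
  zero_sum (symdiff a D) D' = zero_sum a D'.
Proof.
move=> dis; rewrite /zero_sum sum_symdiff setIC dis big_set0 subr0.
by rewrite setDE (setIidPl _) // -disjoints_subset disjoint_sym -setI_eq0 dis.
Qed.

Lemma card3_meet D D' : #|D| = 3%N -> #|D'| = 3%N -> D != D' ->
    (1 < #|D :&: D'|)%N ->
  exists p q, [/\ D :\: D' = [set p], D' :\: D = [set q] & p != q].
Proof.
move=> D3 D'3 neq lt1.
have := cardsID D' D; have := cardsID D D';
  rewrite D3 D'3 [D' :&: D]setIC => e1 e2.
have [eq3|neq3] := eqVneq #|D :&: D'| 3%N.
  case/eqP: neq; transitivity (D :&: D').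
    by apply/esym/eqP; rewrite eqEcard subsetIl D3 eq3.
  by apply/eqP; rewrite eqEcard subsetIr D'3 eq3.
have /cards1P[p pE] : #|D :\: D'| == 1%N by apply/eqP; lia.
have /cards1P[q qE] : #|D' :\: D| == 1%N by apply/eqP; lia.
exists p, q; split=> //; apply/eqP => pq.
have := set11 p; rewrite -pE inE => /andP[_ pD].
by have := set11 q; rewrite -qE -pq inE pD.
Qed.

Lemma zero_sum_meet a D D' : zero_sum a D -> zero_sum a D' -> D != D' ->
  (#|D :&: D'| <= 1)%N.
Proof.
case/andP=> /eqP D3 /eqP Ds /andP[/eqP D'3 /eqP D's] neq.
rewrite leqNgt; apply/negP => /(card3_meet D3 D'3 neq)[p [q [pE qE /eqP]]];
  apply.
rewrite (big_setID D') /= pE big_set1 in Ds.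
rewrite (big_setID D) /= qE big_set1 setIC in D's.
by apply: (@signed_root_inj a); vector.
Qed.

Lemma zero_sum_path_meet a D D' : zero_sum a D -> zero_sum (symdiff a D) D' ->
  D != D' -> (#|D :&: D'| <= 1)%N.
Proof.
case/andP=> /eqP D3 /eqP Ds /andP[/eqP D'3 /eqP];
  rewrite sum_symdiff => D's neq.
rewrite leqNgt; apply/negP => /(card3_meet D3 D'3 neq)[p [q [pE qE _]]].
rewrite (big_setID D') /= pE big_set1 in Ds; rewrite qE big_set1 setIC in D's.
by apply: (@signed_rootN a q p); vector.
Qed.

Lemma disjoint_path_unique a D1 D2 D D' :
    zero_sum a D1 -> zero_sum a D2 -> D1 :&: D2 = set0 ->
    zero_sum a D -> #|D'| = 3%N -> symdiff D D' = symdiff D1 D2 ->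
  D = D1 \/ D = D2.
Proof.
move=> z1 z2 dis z D'3 E; have [/eqP D13 _] := andP z1.
have [/eqP D23 _] := andP z2; have [/eqP D3 _] := andP z.
have [->|neq1] := eqVneq D D1; first by left.
have [->|neq2] := eqVneq D D2; first by right.
have le1 := zero_sum_meet z z1 neq1; have le2 := zero_sum_meet z z2 neq2.
have := card_symdiff D1 D2; have := card_symdiff D D'.
rewrite E dis cards0 D13 D23 D3 D'3 => e1 e2.
have /eqP DD' : #|D :&: D'| == 0%N by apply/eqP; lia.
have sub : D \subset (D :&: D1) :|: (D :&: D2).
  apply/subsetP => x xD; rewrite !in_setU !in_setI xD /=.
  have: x \in symdiff D D'.
    rewrite in_symdiff xD; move/cards0_eq/setP/(_ x): DD'.
    by rewrite in_setI xD inE /= => ->.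
  by rewrite E in_symdiff; case: (x \in D1).
by have := subset_leq_card sub; rewrite cardsU D3; lia.
Qed.

Definition tetrahedron a x1 x2 x3 x4 t s :=
  [/\ uniq [:: x1; x2; x3; x4; t; s], sg a x1 + sg a x2 + sg a t = 0,
      sg a x3 + sg a x4 = sg a t & sg a x1 + sg a x3 + sg a s = 0].

Lemma tetrahedronC a x1 x2 x3 x4 t s :
  tetrahedron a x1 x2 x3 x4 t s -> tetrahedron a x1 x3 x2 x4 s t.
Proof.
case=> u e1 e2 e3; split=> //; last by vector.
rewrite (perm_uniq (s2 := [:: x1; x2; x3; x4; t; s])) //.
by apply/permP => p /=; lia.
Qed.

Lemma tetrahedron_path a x1 x2 x3 x4 t s : tetrahedron a x1 x2 x3 x4 t s ->
  [/\ uniq [:: x1; x2; t], uniq [:: x3; x4; t], zero_sum a [set x1; x2; t] &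
      zero_sum (symdiff a [set x1; x2; t]) [set x3; x4; t]].
Proof.
case=> u e1 e2 e3.
have u1 : uniq [:: x1; x2; t] := (mask_uniq u [:: true; true; false; false;
  true]).
have u2 : uniq [:: x3; x4; t] := (mask_uniq u [:: false; false; true; true;
  true]).
split=> //; first by rewrite zero_sum3 // e1.
rewrite zero_sum3 // !signed_root_symdiff !inE eqxx !orbT.
move: u; rewrite /= !inE !negb_or => /and5P[/and5P[n1 n2 n3 n4 _] ].
move=> /and4P[n5 n6 _ _] /and3P[_ n7 _] /andP[n8 _] _.
rewrite (eq_sym x3 x1) (negPf n2) (eq_sym x3 x2) (negPf n5) (negPf n7).
rewrite (eq_sym x4 x1) (negPf n3) (eq_sym x4 x2) (negPf n6) (negPf n8) /=.
by rewrite e2 subrr.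
Qed.

Lemma tetrahedron_symdiff a x1 x2 x3 x4 t s : tetrahedron a x1 x2 x3 x4 t s ->
  symdiff [set x1; x2; t] [set x3; x4; t] = symdiff [set x1; x3; s] [set x2;
    x4; s].
Proof.
move=> tet; have [u1 u2 _ _] := tetrahedron_path tet.
have [u3 u4 _ _] := tetrahedron_path (tetrahedronC tet).
apply: (@symdiff_inj _ set0); rewrite !symdiffA !symdiff_flips //.
apply/setP => y; rewrite !in_flips /= !oddD !oddb.
by rewrite inE; do 6 case: (_ == y).
Qed.

Lemma tetrahedron_points a x1 x2 x3 x4 t s : tetrahedron a x1 x2 x3 x4 t s ->
  pairwise (fun u v : V => v - u \in R)
    [:: 0; sg a x1; sg a x1 + sg a x2; - sg a x3].
Proof.
case=> _ e1 e2 e3; rewrite /= !subr0 !andbT.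
have -> : sg a x1 + sg a x2 = - sg a t by vector.
have -> : - sg a t - sg a x1 = sg a x2 by vector.
have -> : - sg a x3 - sg a x1 = sg a s by vector.
have -> : - sg a x3 - - sg a t = sg a x4 by vector.
by rewrite !(rootNE BP RP) !signed_rootP.
Qed.

Lemma tetrahedron_intro a x1 x2 x3 x4 t s : uniq [:: x1; x2; x3; x4; t] ->
    sg a x1 + sg a x2 + sg a t = 0 -> sg a x3 + sg a x4 = sg a t ->
    sg a x1 + sg a x3 + sg a s = 0 ->
  tetrahedron a x1 x2 x3 x4 t s.
Proof.
move=> u e1 e2 e3; split=> //.
have nz y : sg a y <> 0 by apply/eqP/(root_neq0 RP)/signed_rootP.
have nd y z : sg a y + sg a y <> - sg a z.
  move=> e; have /negP[] := root_double RP (signed_rootP a y).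
  by rewrite e (rootNE BP RP) signed_rootP.
have n23 : x2 != x3 by case/and3P: u => _; rewrite inE negb_or => /andP[].
rewrite -[[:: _; _; _; _; _; _]]/(rcons [:: x1; x2; x3; x4; t] s) rcons_uniq u.
rewrite andbT !inE !negb_or; apply/and5P; split; apply/eqP => sE;
  rewrite sE in e3.
- by apply: (nd x1 x3); vector.
- by apply: (nz x4); vector.
- by apply: (nd x3 x1); vector.
- by apply: (nz x2); vector.
- by case/eqP: n23; apply: (@signed_root_inj a); vector.
Qed.

Lemma tetrahedron_intro_root a x1 x2 x3 x4 t : uniq [:: x1; x2; x3; x4; t] ->
    sg a x1 + sg a x2 + sg a t = 0 -> sg a x3 + sg a x4 = sg a t ->
    sg a x1 + sg a x3 \in R ->
  exists s, tetrahedron a x1 x2 x3 x4 t s \/ tetrahedron a x2 x1 x4 x3 t s.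
Proof.
move=> u e1 e2 /(root_signed_root a)[s [e3|e3]]; exists s; [right|left].
  by apply: tetrahedron_intro; rewrite -1?uniq5_swap12_34 //; vector.
by apply: tetrahedron_intro; rewrite //; vector.
Qed.

Lemma exists_tetrahedron a D1 D2 : zero_sum a D1 ->
  zero_sum (symdiff a D1) D2 ->
    #|D1 :&: D2| = 1%N ->
  exists x1 x2 x3 x4 t s, [/\ tetrahedron a x1 x2 x3 x4 t s,
    D1 = [set x1; x2; t] & D2 = [set x3; x4; t]].
Proof.
move=> z1 z2 /eqP/cards1P[t tE].
have [/eqP D13 /eqP sum1] := andP z1; have [/eqP D23] := andP z2.
rewrite sum_symdiff setIC tE big_set1 => /eqP sum2.
have := cardsID D2 D1; have := cardsID D1 D2.
rewrite (setIC D2) tE cards1 D13 D23 => c1 c2.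
have /cards2P[x1 [x2 [n12 E1]]] : #|D1 :\: D2| == 2%N by apply/eqP; lia.
have /cards2P[x3 [x4 [n34 E2]]] : #|D2 :\: D1| == 2%N by apply/eqP; lia.
move: sum1 sum2; rewrite (big_setID D2) /= tE E1 E2 big_set1.
rewrite !big_setU1 ?inE //= !big_set1 => e1 /eqP; rewrite subr_eq0 => /eqP e2.
have D1E : D1 = [set x1; x2; t] by rewrite -(setID D1 D2) tE E1 setUC.
have D2E : D2 = [set x3; x4;
  t] by rewrite -(setID D2 D1) (setIC D2) tE E2 setUC.
have u5 : uniq [:: x1; x2; x3; x4; t].
  apply/card_uniqP; transitivity #|D1 :|: D2|.
    apply: eq_card => y; rewrite D1E D2E !inE.
    by case: (y == x1); case: (y == x2); case: (y == t); rewrite ?orbT ?orbF.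
  by rewrite cardsU D13 D23 tE cards1.
suff [s [y1 [y2 [y3 [y4 [tet E1' E2']]]]]] : exists s y1 y2 y3 y4,
    [/\ tetrahedron a y1 y2 y3 y4 t s, [set x1; x2] = [set y1; y2] &
        [set x3; x4] = [set y3; y4]].
  by exists y1, y2, y3, y4, t, s; rewrite D1E D2E E1' E2'.
have n13 : sg a x1 + sg a x3 != 0.
  by apply/eqP => e; apply: (@signed_rootN a x1 x3); vector.
have n14 : sg a x1 + sg a x4 != 0.
  by apply/eqP => e; apply: (@signed_rootN a x1 x4); vector.
have s12 : sg a x1 + sg a x2 + sg a x3 + sg a x4 = 0 by vector.
have r12 : sg a x1 + sg a x2 \in R.
  have -> : sg a x1 + sg a x2 = - sg a t by vector.
  by rewrite (rootNE BP RP) signed_rootP.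
have rs : [/\ sg a x1 \in R, sg a x2 \in R, sg a x3 \in R & sg a x4 \in R].
  by split; apply: signed_rootP.
have {}e1 : sg a x1 + sg a x2 + sg a t = 0 by vector.
have [r13|r14] := root_quadruple BP RP rs s12 n13 n14 r12.
  have [s [tet|tet]] := tetrahedron_intro_root u5 e1 e2 r13.
    by exists s, x1, x2, x3, x4.
  by exists s, x2, x1, x4, x3; split=> //; rewrite setUC.
have {}e2 : sg a x4 + sg a x3 = sg a t by rewrite addrC e2.
have [s [tet|tet]] := tetrahedron_intro_root (etrans (uniq5_swap34 _ _ _ _ _)
  u5) e1 e2 r14.
  by exists s, x1, x2, x4, x3; split=> //; rewrite setUC.
by exists s, x2, x1, x3, x4; split=> //; rewrite setUC.
Qed.

Variable br : {ffun P -> int} -> {ffun P -> int} -> {ffun P -> int}.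
Hypothesis brP : root_bracket br.

Lemma tetrahedron_path_unique a x1 x2 x3 x4 t s D D' :
    tetrahedron a x1 x2 x3 x4 t s ->
    zero_sum a D -> zero_sum (symdiff a D) D' ->
    symdiff D D' = symdiff [set x1; x2; t] [set x3; x4; t] ->
  D = [set x1; x2; t] \/ D = [set x1; x3; s].
Proof.
move=> tet z z' E; have [u1 u2 z1 z2] := tetrahedron_path tet.
case: (tet) => u e1 e2 e3.
have [/eqP D3 /eqP] := andP z; have [/eqP D'3 _] := andP z'.
have meet : #|D :&: D'| = 1%N.
  have neq : [set x1; x2; t] != [set x3; x4; t].
    have : x1 \notin [set x3; x4; t].
      by move: u; rewrite /= !inE !negb_or => /andP[/and5P[_ -> -> -> _] _].
    by apply: contraNneq => <-; rewrite !inE eqxx.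
  have m1 : #|[set x1; x2; t] :&: [set x3; x4; t]| = 1%N.
    apply/eqP; rewrite eqn_leq (zero_sum_path_meet z1 z2 neq).
    by apply/card_gt0P; exists t; rewrite !inE eqxx !orbT.
  have := card_symdiff D D'; have := card_symdiff [set x1; x2; t] [set x3; x4;
    t].
  by rewrite E D3 D'3 !cards3 // m1 => <- /addnI/double_inj.
have /cards1P[w wE] : #|D :&: D'| == 1%N by rewrite meet.
have := cardsID D' D; rewrite meet D3 => c1.
have /cards2P[i [j [nij E1]]] : #|D :\: D'| == 2%N by apply/eqP; lia.
rewrite (big_setID D') /= wE E1 big_set1 big_setU1 ?inE //= big_set1 => eD.
have DE : D = [set i; j; w] by rewrite -(setID D D') wE E1 setUC.
have in4 y : y \in [set i; j] -> y \in [:: x1; x2; x3; x4].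
  rewrite -E1 inE => /andP[yD' yD].
  have: y \in symdiff D D' by rewrite in_symdiff yD (negPf yD').
  rewrite E in_symdiff !inE.
  by case: (y == x1); case: (y == x2); case: (y == x3); case: (y == x4);
    rewrite ?orbT //=; case: (y == t).
have n23 : sg a x2 + sg a x3 \notin R.
  have [_ + _] := four_points_nonroot BP RP PP brP (tetrahedron_points tet).
  by rewrite (_ : _ - _ = sg a x2 + sg a x3) //; vector.
have n14 : sg a x1 + sg a x4 \notin R.
  rewrite (_ : _ + _ = - (sg a x2 + sg a x3)) ?(rootNE BP RP) //; vector.
have iin : i \in [:: x1; x2; x3; x4] by apply: in4; rewrite !inE eqxx.
have jin : j \in [:: x1; x2; x3; x4] by apply: in4; rewrite !inE eqxx orbT.
have {}eD : sg a i + sg a j + sg a w = 0 by vector.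
have {}eD : sg a i + sg a j = - sg a w by vector.
clear E wE E1 z z' in4 c1 meet D3 D'3.
move: iin jin; rewrite !inE => /or4P[] /eqP iE /or4P[] /eqP jE; subst i j;
  rewrite ?eqxx // in nij.
- left; rewrite DE; congr (_ :|: [set _]); apply: (@signed_root_inj a); vector.
- right; rewrite DE; congr (_ :|: [set _]); apply: (@signed_root_inj a); vector.
- by case/negP: n14; rewrite eD (rootNE BP RP) signed_rootP.
- left; rewrite DE setUC [[set x2; x1]]setUC setUC; congr (_ :|: [set _]).
  by apply: (@signed_root_inj a); vector.
- by case/negP: n23; rewrite eD (rootNE BP RP) signed_rootP.
- by case: (@signed_rootN a w s); vector.
- right; rewrite DE setUC [[set x3; x1]]setUC setUC; congr (_ :|: [set _]).
  by apply: (@signed_root_inj a); vector.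
- by case/negP: n23; rewrite addrC eD (rootNE BP RP) signed_rootP.
- by case: (@signed_rootN a w t); vector.
- by case/negP: n14; rewrite addrC eD (rootNE BP RP) signed_rootP.
- by case: (@signed_rootN a w s); vector.
- by case: (@signed_rootN a w t); vector.
Qed.

Local Notation G := (root_graph Rp).

Definition opposite_vertex a b c d :=
  (exists D1 D2, [/\ zero_sum a D1, zero_sum a D2 & D1 :&: D2 = set0] /\
     [/\ b = symdiff a D1, c = symdiff b D2 & d = symdiff a D2]) \/
  (exists x1 x2 x3 x4 t s, tetrahedron a x1 x2 x3 x4 t s /\
     [/\ b = symdiff a [set x1; x2; t], c = symdiff b [set x3; x4; t] &
         d = symdiff a [set x1; x3; s]]).

Lemma exists_opposite_vertex a b c : G a b -> G b c -> a != c ->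
  exists d, opposite_vertex a b c d.
Proof.
rewrite !root_graphE; set D1 := symdiff a b; set D2 := symdiff b c => z1 z2 ac.
have bE : b = symdiff a D1 by rewrite symdiffK.
have cE : c = symdiff b D2 by rewrite symdiffK.
have D12 : D1 != D2.
  by apply: contraNneq ac => E; rewrite cE -E /D1 (symdiffC a) symdiffK.
have := z2; rewrite {1}bE => z2'; have := zero_sum_path_meet z1 z2' D12.
rewrite leq_eqVlt ltnS leqn0 cards_eq0 => /orP[/eqP meet|/eqP dis].
  have [x1 [x2 [x3 [x4 [t [s [tet D1E D2E]]]]]]] := exists_tetrahedron z1 z2'
    meet.
  exists (symdiff a [set x1; x3; s]); right; exists x1, x2, x3, x4, t, s.
  by rewrite -D1E -D2E.
exists (symdiff a D2); left; exists D1, D2; split=> //; split=> //.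
by rewrite -(zero_sum_disjoint a dis).
Qed.

Lemma opposite_vertex_neighbor a b c d : opposite_vertex a b c d ->
  [/\ d != b, G a d & G d c].
Proof.
case=> [[D1 [D2 [[z1 z2 dis] [-> -> ->]]]]|].
  rewrite !root_graphE symdiffK (symdiff_path _ (symdiffC D1 D2)).
  have dis' : D2 :&: D1 = set0 by rewrite setIC.
  rewrite z2 (zero_sum_disjoint _ dis') z1; split=> //.
  apply: contraTneq z1 => /symdiff_inj D21.
  by rewrite /zero_sum -[D1]setIid -{2}D21 dis cards0.
move=> [x1 [x2 [x3 [x4 [t [s [tet [-> -> ->]]]]]]]].
have [_ _ z z'] := tetrahedron_path (tetrahedronC tet).
rewrite !root_graphE symdiffK (symdiff_path _ (tetrahedron_symdiff tet)) z z'.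
split=> //; have : x2 \notin [set x1; x3; s].
  case: tet => + _ _ _; rewrite /= !inE !negb_or.
  by move=> /andP[/andP[+ _] /andP[/and4P[-> _ _ ->] _]]; rewrite eq_sym => ->.
by apply: contraNneq => /symdiff_inj ->; rewrite !inE eqxx orbT.
Qed.

Lemma opposite_vertex_unique a b c d (e : {set P}) : opposite_vertex a b c d ->
  G a e -> G e c -> e = b \/ e = d.
Proof.
rewrite !root_graphE => + ze1 ze2.
have eE : e = symdiff a (symdiff a e) by rewrite symdiffK.
have ceE : symdiff (symdiff a e) (symdiff e c) = symdiff a c.
  by rewrite -symdiffA symdiffK.
have [/eqP ze3 _] := andP ze2.
move: (ze2); rewrite {1}eE => ze2'.
case=> [[D1 [D2 [[z1 z2 dis] [bE cE ->]]]]|].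
  have acE : symdiff a c = symdiff D1 D2 by rewrite cE bE -symdiffA symdiffK.
  rewrite eE bE.
  have := disjoint_path_unique z1 z2 dis ze1 ze3; rewrite ceE acE => /(_ erefl).
  by case=> ->; [left|right].
move=> [x1 [x2 [x3 [x4 [t [s [tet [bE cE ->]]]]]]]].
have acE : symdiff a c = symdiff [set x1; x2; t] [set x3; x4; t].
  by rewrite cE bE -symdiffA symdiffK.
rewrite eE bE; have := tetrahedron_path_unique tet ze1 ze2'.
by rewrite ceE acE => /(_ erefl)[] ->; [left|right].
Qed.

Lemma root_graph_no_chord a b c : G a b -> G b c -> ~~ G a c.
Proof.
rewrite !root_graphE => /andP[/eqP ab3 _] /andP[/eqP bc3 _].
apply/negP => /andP[/eqP ac3 _].
have := card_symdiff (symdiff a b) (symdiff b c).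
by rewrite -symdiffA symdiffK ac3 ab3 bc3; lia.
Qed.

Lemma root_graph_sym : symmetric G.
Proof.
move=> a b; rewrite !root_graphE symdiffC -(zero_sum_symdiffK b).
by rewrite symdiffK.
Qed.

Lemma root_graph_irreflexive : irreflexive G.
Proof. by move=> a; rewrite root_graphE symdiffvv /zero_sum cards0. Qed.

Lemma root_graph_diamond_graph : diamond_graph G.
Proof.
split; first by split; [exact: root_graph_sym | exact: root_graph_irreflexive].
move=> a b c /and3P[_ _ ac] Gab Gbc.
have [d opp] := exists_opposite_vertex Gab Gbc ac.
have [db Gad Gdc] := opposite_vertex_neighbor opp.
exists d; split.
  split; rewrite ?db ?Gad ?Gdc // (root_graph_no_chord Gab Gbc).
  by rewrite root_graph_sym in Gab; rewrite (root_graph_no_chord Gab Gad).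
move=> e [eb /andP[Gae Gec] _].
by case: (opposite_vertex_unique opp Gae Gec) => // ebE; rewrite ebE eqxx in eb.
Qed.

Lemma diamond_opposite_vertex a b c d : diamond G a b c d ->
  opposite_vertex a b c d.
Proof.
move=> [/and3P[_ _ ac] /andP[Gab Gbc] db /andP[Gad Gdc] _].
have [e opp] := exists_opposite_vertex Gab Gbc ac.
by case: (opposite_vertex_unique opp Gad Gdc) => dE;
  [rewrite dE eqxx in db | rewrite dE].
Qed.

Lemma root_graph_card a b : G a b -> #|a| = #|b|.+1 \/ #|b| = #|a|.+1.
Proof.
rewrite root_graphE => /zero_sumP[e [e1 [e2 [u abE _ e2a ea]]]].
have := card_symdiff3 u e2a ea; rewrite -abE symdiffK.
by case: ifP => _ ->; [left|right].
Qed.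

Local Notation K := (triple_constant br).

Lemma tetrahedron_constants a x1 x2 x3 x4 t s : tetrahedron a x1 x2 x3 x4 t s ->
  K x1 x2 t * K t x4 x3 * K x1 s x3 * K x2 x4 s = 1.
Proof.
have pm x u : sg a x = u \/ sg a x = - u -> val x = u \/ val x = - u.
  rewrite /sg; case: ifP => // _ [] /(congr1 -%R); rewrite !opprK;
    by [right|left].
move=> tet; have [_ e1 e2 e3] := tet.
apply: (four_points_constants BP RP PP brP (tetrahedron_points tet)).
  by split; apply: pm; [left|right|right]; vector.
by split; apply: pm; [left|left|left]; vector.
Qed.

End RootGraph.

(** * The differential in the standard basis *)

Section Differential.
Variables (T : finType) (le : rel T).
Variable br : {ffun T -> int} -> {ffun T -> int} -> {ffun T -> int}.
Hypothesis leP : total_order le.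
Implicit Types (a b s : {set T}) (p q x y : T).

Let lt p q := ~~ le q p.

Lemma ext_gen_mul_basis x s : (ext_gen le x) * (zbasis s : exterior le) =
  if x \in s then 0 else (zbasis (x |: s) : exterior le) *~ before_sign le s x.
Proof.
rewrite [LHS]ext_mul_zbasis /ext_mul_basis disjoints1.
by case: (x \in s) => //=; rewrite /inversions big_set1 expr_sum.
Qed.

Lemma ext_lin_mul_basis (u : {ffun T -> int}) s b :
  (ext_lin le u * (zbasis s : exterior le)) b =
  \sum_(x | x \notin s) u x * before_sign le s x * (b == x |: s)%:R.
Proof.
rewrite /ext_lin /zextend mulr_suml sum_ffunE [RHS]big_mkcond /=.
apply: eq_bigr => x _; rewrite mulrzAl ffunMzE ext_gen_mul_basis.
case: (x \in s) => /=; first by rewrite ffunE mul0rz.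
by rewrite ffunMzE ffunE !mulrzz; ring.
Qed.

Let mem_ordered a x : (x \in ordered_seq le a) = (x \in a).
Proof. by rewrite mem_sort mem_enum. Qed.

Let ordered_uniq a : uniq (ordered_seq le a).
Proof. by rewrite sort_uniq enum_uniq. Qed.

Let ordered_sorted a : sorted le (ordered_seq le a).
Proof. by case: leP => _ _ _ tot; apply: sort_sorted. Qed.

Let item a := tnth (in_tuple (ordered_seq le a)).

Let item_inj a : injective (@item a).
Proof. by apply/tuple_uniqP; apply: ordered_uniq. Qed.

Let le_item a i j : le (@item a i) (@item a j) = (i <= j)%N.
Proof.
case: leP => refl anti tr _.
have homo (k l : 'I_(size (ordered_seq le a))) : (k <= l)%N ->
  le (@item a k) (@item a l).
  rewrite /item !(tnth_nth (@item a k)) => kl.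
  by apply: sorted_leq_nth; rewrite ?inE ?ordered_sorted ?size_tuple.
have [/homo-> //|lt_ji] := leqP i j.
apply/negP => leij; move: (lt_ji).
by rewrite (@item_inj a i j) ?ltnn //; apply: anti; rewrite leij homo // ltnW.
Qed.

Let big_ordered (A : Type) (z : A) (op : Monoid.com_law z) (f : T ->
  A) a (Q : pred T) :
  \big[op/z]_(i < size (ordered_seq le a) | Q (@item a i)) f (@item a i) =
  \big[op/z]_(p in a | Q p) f p.
Proof.
rewrite -big_tnth big_mkcond /= big_uniq //= -big_mkcondr.
by apply: eq_bigl => p; rewrite mem_ordered.
Qed.

Lemma before_sign_nth a (i : 'I_(size (ordered_seq le a))) :
  before_sign le a (@item a i) = (-1) ^+ i.
Proof.
rewrite /before_sign -expr_sum; congr (_ ^+ _).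
rewrite (eq_bigl (fun y => (y \in a) && true)) => [|y]; last by rewrite andbT.
rewrite -(@big_ordered _ _ _ (fun y =>
  nat_of_bool (~~ le (@item a i) y)) a xpredT).
rewrite (eq_bigr (fun j : 'I__ => nat_of_bool (j < i)%N)) => [|j _].
  by rewrite -big_mkcond -(big_ord_widen _ (fun=> 1%N)) ?sum1_card ?card_ord //
    ltnW.
by rewrite le_item ltnNge.
Qed.

Lemma ext_prod_but2 a (i j : 'I_(size (ordered_seq le a))) :
  \prod_(k < size (ordered_seq le a) | (k != i) && (k != j)) ext_gen le (@item
    a k) =
  zbasis (a :\: [set @item a i; @item a j]).
Proof.
pose Q x := (x != @item a i) && (x != @item a j).
rewrite (eq_bigl (fun k => Q (@item a k))) => [|k]; last first.
  by rewrite /Q !(inj_eq (@item_inj a)).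
case: leP => _ _ tr _; rewrite -(big_tnth _ _ (ordered_seq le a) Q) -big_filter.
rewrite ext_sorted_prod ?sorted_filter ?filter_uniq ?ordered_sorted
  ?ordered_uniq //.
by congr zbasis; apply/setP => x;
  rewrite !inE mem_filter mem_ordered /Q negb_or.
Qed.

Lemma ext_d_basis a : ext_d le br (zbasis a) = \sum_(p in a) \sum_(q in a | lt
  p q)
  (ext_lin le (br (zbasis p) (zbasis q)) * (zbasis (a :\: [set p;
    q]) : exterior le))
    *~ flip_sign le a [:: p; q].
Proof.
rewrite /ext_d zextend_basis /ext_d_seq.
rewrite [RHS](eq_bigl (fun p => (p \in a) && true)) => [|p];
  last by rewrite andbT.
rewrite -[RHS](@big_ordered _ _ _ _ a xpredT); apply: eq_bigr => i _.
rewrite -[RHS](@big_ordered _ _ _ _ a (lt (@item a i))).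
apply: eq_big => [j|j ij]; first by rewrite /lt le_item ltnNge.
rewrite ext_prod_but2; congr (_ *~ _).
rewrite /= mulr1 before_sign_flip !before_sign_nth le_item leqNgt ij /= expr1.
rewrite mulrN1 mulrN -exprD -[RHS]mulN1r -exprS.
rewrite -signr_odd -[RHS]signr_odd; congr ((-1) ^+ nat_of_bool _).
by move: ij; lia.
Qed.

Lemma ext_d_coefE a b : (ext_d le br (zbasis a)) b =
  \sum_(p in a) \sum_(q in a | lt p q) \sum_(x | x \notin a :\: [set p; q])
     br (zbasis p) (zbasis q) x * before_sign le (a :\: [set p; q]) x *
     (b == x |: (a :\: [set p; q]))%:R * flip_sign le a [:: p; q].
Proof.
rewrite ext_d_basis sum_ffunE; apply: eq_bigr => p _.
rewrite sum_ffunE; apply: eq_bigr => q _.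
by rewrite ffunMzE ext_lin_mul_basis mulrzz mulr_suml.
Qed.

Lemma ext_d_support a b : (ext_d le br (zbasis a)) b != 0 ->
  exists p q x, [/\ p \in a, q \in a,
    p != q & br (zbasis p) (zbasis q) x != 0] /\
    (x \notin a :\: [set p; q] /\ b = x |: (a :\: [set p; q])).
Proof.
rewrite ext_d_coefE => /eqP nz.
case: (pickP (fun u : T * T * T => [&& u.1.1 \in a, u.1.2 \in a, lt u.1.1 u.1.2,
  br (zbasis u.1.1) (zbasis u.1.2) u.2 != 0, u.2 \notin a :\: [set u.1.1;
    u.1.2] &
  b == u.2 |: (a :\: [set u.1.1; u.1.2])])).
  move=> [[p q] x] /= /and5P[pa qa pq c0 /andP[xa /eqP bE]]; exists p, q, x;
    split=> //.
  split=> //; apply: contraNneq pq => ->.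
  by case: leP => refl _ _ _; apply: refl.
move=> none; case: nz; apply: big1 => p pa; apply: big1 => q /andP[qa pq].
apply: big1 => x xa; have := none (p, q, x); rewrite /= pa qa pq xa /=.
case: eqP => [->|_]; rewrite ?mul0r //=.
by move=> ->; rewrite mulr0 mul0r.
Qed.

Lemma ext_d_coef a p q x : p \in a -> q \in a -> p != q -> x \notin a ->
    br (zbasis p) (zbasis q) x = - br (zbasis q) (zbasis p) x ->
  ext_d le br (zbasis a) (flips a [:: p; q; x]) =
  br (zbasis p) (zbasis q) x * flip_sign le a [:: p; q; x].
Proof.
wlog pq : p q / lt p q.
  move=> sym pa qa npq xa C; have [] : lt p q \/ lt q p.
    rewrite /lt; case: leP => _ anti _ _.
    case: (boolP (le q p)); case: (boolP (le p q)) => lpq lqp /=; auto.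
    by case/eqP: npq; apply: anti; rewrite lpq lqp.
  - by move=> pq; apply: sym.
  - move=> qp; have -> : flips a [:: p; q; x] = flips a [:: q; p; x].
      by congr (flip _ x); apply: flipC.
    have nqp : q != p by rewrite eq_sym.
    rewrite sym //; last by rewrite C opprK.
    by rewrite (flip_signC leP) // C; ring.
move=> pa qa npq xa _.
set b := flips a _; set s := a :\: [set p; q].
have qp : q == p = false by rewrite eq_sym (negPf npq).
have xs : x \notin s by rewrite inE negb_and xa orbT.
have sE : s = flip (flip a p) q.
  apply/setP => y; rewrite !in_symdiff !inE.
  have [->|yp] := eqVneq y p; first by rewrite pa (negPf npq).
  by have [->|yq] := eqVneq y q; rewrite ?qa // !addbF.
have bE : b = x |: s.
  rewrite /b /= -sE; apply/setP => y; rewrite in_symdiff in_set1 in_setU1.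
  by have [->|_] := eqVneq y x; rewrite ?(negPf xs) ?addbF.
have abE (p' q' x' : T) : p' \in a -> q' \in a -> lt p' q' ->
    b = x' |: (a :\: [set p'; q']) -> [/\ p' = p, q' = q & x' = x].
  move=> p'a q'a p'q' bE'.
  have x'E : x' = x.
    have: x \in b by rewrite bE setU11.
    by rewrite bE' !inE (negPf xa) andbF orbF => /eqP.
  have aE : a :\: b = [set p; q].
    apply/setP => y; rewrite bE !inE; have [->|yx] := eqVneq y x.
      by rewrite (negPf xa) /=; symmetry; apply/norP; split;
        apply: contraNneq xa => ->.
    have [->|yp] := eqVneq y p; first by rewrite pa.
    by have [->|yq] := eqVneq y q; [rewrite qa | case: (y \in a)].
  have aE' : a :\: b = [set p'; q'].
    apply/setP => y; rewrite bE' x'E !inE; have [->|yx] := eqVneq y x.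
      by rewrite (negPf xa) /=; symmetry; apply/norP; split;
        apply: contraNneq xa => ->.
    have [->|yp] := eqVneq y p'; first by rewrite p'a.
    by have [->|yq] := eqVneq y q'; [rewrite q'a | case: (y \in a)].
  have asym u v : lt u v -> lt v u = false.
    by rewrite /lt; case: leP => _ _ _ tot; have := tot u v; case: (le v u);
      case: (le u v).
  have pset : p' \in [set p; q] by rewrite -aE aE' !inE eqxx.
  have qset : q' \in [set p; q] by rewrite -aE aE' !inE eqxx orbT.
  have irr u : lt u u = false by rewrite /lt; case: leP => refl _ _ _;
    rewrite refl.
  move: pset qset p'q'; rewrite !inE => /orP[] /eqP -> /orP[] /eqP ->;
    by rewrite ?irr ?(asym _ _ pq).
rewrite ext_d_coefE (bigD1 p) //= (bigD1 q) ?qa //= (bigD1 x) //= -/s.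
rewrite bE eqxx big1 => [|y /andP[ys yx]]; last first.
  case: eqP => [E|_]; last by rewrite mulr0 mul0r.
  have [_ _ yE] := abE p q y pa qa pq (etrans bE E).
  by rewrite yE eqxx in yx.
rewrite big1 => [|q' /andP[/andP[q'a pq'] q'q]]; last first.
  apply: big1 => y ys; case: eqP => [E|_]; last by rewrite mulr0 mul0r.
  have [_ q'E _] := abE p q' y pa q'a pq' (etrans bE E).
  by rewrite q'E eqxx in q'q.
rewrite big1 => [|p' /andP[p'a p'p]]; last first.
  apply: big1 => q' /andP[q'a pq'].
  apply: big1 => y ys; case: eqP => [E|_]; last by rewrite mulr0 mul0r.
  have [p'E _ _] := abE p' q' y p'a q'a pq' (etrans bE E).
  by rewrite p'E eqxx in p'p.
by rewrite sE !addr0 mulr1 /=; ring.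
Qed.

End Differential.

(** * Diamond complexes *)

Lemma int_mul_eq1 (x y : int) : x * y = 1 -> x = y.
Proof.
move=> xy; have /intUnitRing.unitzPl/orP[] := xy => /eqP yE.
  by move: xy; rewrite yE mulr1.
by move: xy; rewrite yE mulrN1 => <-; rewrite opprK.
Qed.

Lemma two_steps (x y z k : int) : k = 1 \/ k = -1 -> z = x + k + k ->
  x = y + 1 \/ x = y - 1 -> y = z + 1 \/ y = z - 1 -> y = x + k.
Proof. by lia. Qed.

Lemma one_step (x y : int) : x = y + 1 \/ x = y - 1 -> x <> y.
Proof. by lia. Qed.

Section DiamondComplex.
Variables (T : finType) (G : rel T) (phi : T -> T -> int) (deg : T ->
  int) (k : int).
Variable d : {ffun T -> int} -> {ffun T -> int}.
Hypotheses (kP : k = 1 \/ k = -1) (dB : zmod_morphism d).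
Hypotheses (GP : diamond_graph G) (degP : graph_grading G deg).
Hypothesis phiP : sign_function G phi.

Lemma basis_sum_coef (Q : pred T) (f : T -> int) b :
  (\sum_(a | Q a) zbasis a *~ f a) b = if Q b then f b else 0.
Proof.
rewrite sum_ffunE; have [Qb|Qb] := boolP (Q b).
  rewrite (bigD1 b) //= big1 => [|a /andP[_ /negPf ab]].
    by rewrite ffunMzE ffunE eqxx addr0 intz.
  by rewrite ffunMzE ffunE eq_sym ab mul0rz.
rewrite big1 // => a Qa; rewrite ffunMzE ffunE.
by case: eqP Qb => [->|]; rewrite ?Qa ?mul0rz.
Qed.

Hypothesis dE : forall a, d (zbasis a) =
  \sum_(b | (deg b == deg a + k) && G a b) zbasis b *~ phi a b.

Let d_coef a b :
  d (zbasis a) b = if (deg b == deg a + k) && G a b then phi a b else 0.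
Proof. by rewrite dE basis_sum_coef. Qed.

Let d_sum u b : d u b = \sum_a d (zbasis a) b * u a.
Proof.
rewrite (zmod_morphism_zextend dB) /zextend sum_ffunE; apply: eq_bigr => a _.
by rewrite ffunMzE mulrzz.
Qed.

Lemma diamond_homogeneous n u :
  homogeneous deg n u -> homogeneous deg (n + k) (d u).
Proof.
move=> hu b; apply: contraNeq => nb; apply/eqP; rewrite d_sum big1 // => a _.
have [->|/hu an] := eqVneq (u a) 0; first by rewrite mulr0.
by rewrite d_coef an (negPf nb) mul0r.
Qed.

Lemma diamond_square0 u : d (d u) = 0.
Proof.
move: u; apply: (@zextend_eq _ _ (d \o d) (fun=> 0)) => [u v|u v|a] /=.
- by rewrite !dB.
- by rewrite subr0.
apply/ffunP => c; rewrite d_sum ffunE.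
pose Q b := [&& deg b == deg a + k, G a b, deg c == deg b + k & G b c].
rewrite (bigID Q) /= [X in _ + X]big1 => [|b]; last first.
  move/negP => nQ; rewrite !d_coef.
  case: ifP => [/andP[h1 h2]|]; last by rewrite mul0r.
  case: ifP => [/andP[h3 h4]|]; last by rewrite mulr0.
  by case: nQ; rewrite /Q h1 h2 h3 h4.
rewrite addr0; have [b Qb|none] := pickP Q; last by rewrite big_pred0.
have [/eqP ab Gab /eqP bc Gbc] := and4P Qb.
have [[Gsym Girr] Gdia] := GP.
have ac : a != c by apply/eqP => ac; move: bc; rewrite -ac; case: kP; lia.
have nab : a != b by apply: contraTneq Gab => ->; rewrite Girr.
have nbc : b != c by apply: contraTneq Gbc => ->; rewrite Girr.
have abc : [&& a != b, b != c & a != c] by rewrite nab nbc.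
have [x [[xb xe xn] uniq_x]] := Gdia a b c abc Gab Gbc.
have [Gax Gxc] := andP xe.
have degx : deg x = deg a + k.
  by apply: two_steps kP _ (degP Gax) (degP Gxc); rewrite bc ab.
have Qx : Q x by rewrite /Q Gax Gxc degx bc ab !eqxx.
rewrite (bigD1 b) //= (bigD1 x) /= ?Qx // big1 => [|y]; last first.
  case/andP=> /andP[/and4P[/eqP degy Gay _ Gyc] yb] yx.
  case/eqP: yx; apply/esym/uniq_x; split=> //; first by rewrite Gay.
  have [/= -> _] := andP xn; apply/negP => /degP/one_step.
  by rewrite degy ab.
have [_ _ sign] := phiP; rewrite !d_coef bc ab Gab Gbc degx Gax Gxc !eqxx /=.
rewrite addr0 mulrC [X in _ + X]mulrC; apply: sign; split=> //.
by rewrite Gab.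
Qed.

End DiamondComplex.

Section PositiveRootComplex.
Variables (F : realFieldType) (V : vectType F) (B : V -> V -> F).
Variables (R Rp : seq V).
Local Notation P := (seq_sub Rp).
Variables (le : rel P).
Variable br : {ffun P -> int} -> {ffun P -> int} -> {ffun P -> int}.
Hypotheses (BP : inner_product B) (RP : root_system B R).
Hypotheses (PP : positive_system R Rp) (brP : root_bracket br).
Hypothesis leP : total_order le.
Implicit Types (a b c : {set P}) (x y z : P).

Local Notation G := (root_graph Rp).
Local Notation d := (ext_d le br).
Local Notation K := (triple_constant br).

Definition edge_sign a b : int :=
  if (#|b| < #|a|)%N then d (zbasis a) b else d (zbasis b) a.
Local Notation phi := edge_sign.

Let direction a b : int := if (#|b| < #|a|)%N then 1 else -1.

Let triple_sign a x y z := K x y z * flip_sign le a [:: x; y; z].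

Let triple_sign_rot a x y z : uniq [:: x; y; z] ->
  triple_sign a y z x = triple_sign a x y z.
Proof.
rewrite /triple_sign triple_constant_rot => /andP[xyz _]; congr (_ * _).
by have /= -> := @flip_sign_move _ _ leP a x [:: y; z] [::] xyz;
  rewrite sqrrN expr1n mul1r.
Qed.

Let triple_sign_swap a x y z : uniq [:: x; y; z] ->
  triple_sign a y x z = triple_sign a x y z.
Proof.
rewrite /= inE negb_or => /andP[/andP[xy _] _].
rewrite /triple_sign (triple_constant_rot br z y x) (triple_constant_rot br x z
  y).
by rewrite (triple_constant_swap brP) (flip_signC leP) 1?eq_sym //; ring.
Qed.

Let triple_sign_set a x y z x' y' z' : uniq [:: x; y; z] -> uniq [:: x'; y';
  z'] ->
  [set x; y; z] = [set x'; y';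
    z'] -> triple_sign a x y z = triple_sign a x' y' z'.
Proof.
move=> u u' E.
have r1 := triple_sign_rot a u'.
have u1 : uniq [:: y'; z'; x'] by rewrite -(rot_uniq 2).
have u2 : uniq [:: y'; x'; z'] 
  by rewrite -[[:: _; _; _]]/([:: y'] ++ [:: x'] ++ [:: z']) uniq_catCA.
have r2 := triple_sign_rot a u1; rewrite r1 in r2.
have r3 := triple_sign_swap a u'.
have r4 := triple_sign_rot a u2; rewrite r3 in r4.
have u3 : uniq [:: x'; z'; y'] by rewrite -(rot_uniq 2).
have r5 := triple_sign_rot a u3; rewrite r4 in r5.
have xE : x \in [set x'; y'; z'] by rewrite -E !inE eqxx.
have yE : y \in [set x'; y'; z'] by rewrite -E !inE eqxx orbT.
have zE : z \in [set x'; y'; z'] by rewrite -E !inE eqxx orbT.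
clear E; rewrite !inE -!orbA in xE yE zE; rewrite /= !inE negb_or andbT in u.
by case/or3P: xE u => /eqP ->; case/or3P: yE => /eqP ->; rewrite ?eqxx //=;
  case/or3P: zE => /eqP ->; rewrite ?eqxx ?andbF.
Qed.

Let ext_d_edge a x y z : x \in a -> y \in a -> z \notin a ->
  val z = val x + val y ->
  uniq [:: x; y; z] -> d (zbasis a) (flips a [:: x; y;
    z]) = triple_sign a x y z.
Proof.
move=> xa ya za zE /= /andP[]; rewrite !inE negb_or => /andP[xy xz] _.
rewrite (ext_d_coef leP) //; last exact: (structure_constantC brP y x z).
by rewrite /triple_sign (triple_constantE RP PP brP zE).
Qed.

Lemma edge_signE a b x y z : G a b -> symdiff a b = [set x; y; z] ->
    uniq [:: x; y; z] ->
  phi a b = direction a b * triple_sign a x y z.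
Proof.
move=> Gab abE u; have := Gab.
rewrite (root_graphE BP RP PP) => /(zero_sumP BP RP PP)[e [e1 [e2]]].
move=> [u' abE' eE e2a ea].
have bE : b = flips a [:: e1; e2;
  e] by rewrite -symdiff_flips // -abE' symdiffK.
have := card_symdiff3 u' e2a ea; rewrite -abE' symdiffK.
rewrite (triple_sign_set a u u') -?abE // /phi /direction.
have [e1a|e1a] := boolP (e1 \in a) => card_ab.
  rewrite card_ab ltnSn mul1r bE ext_d_edge ?e2a ?ea ?e1a //.
rewrite card_ab ltnNge leqnSn /= mulN1r.
have bflip t : t \in [set e1; e2; e] -> (t \in b) = (t \notin a).
  by rewrite -abE' in_symdiff; case: (t \in a); case: (t \in b).
have aE : a = flips b [:: e1; e2; e].
  by rewrite -symdiff_flips // -abE' symdiffC -symdiffA symdiffvv;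
    apply/setP => t; rewrite in_symdiff inE addbF.
have -> : d (zbasis b) a = triple_sign b e1 e2 e.
  by rewrite {1}aE ext_d_edge // bflip ?e2a ?ea ?e1a // !inE eqxx ?orbT.
by rewrite /triple_sign bE (flip_sign_triple leP) // mulrN.
Qed.

Lemma edge_signC a b : G a b -> phi a b = phi b a.
Proof.
by rewrite /phi => /(root_graph_card BP RP PP)[] ->;
  rewrite ltnSn ltnNge leqnSn.
Qed.

Lemma edge_sign_unit a b : G a b -> phi a b = 1 \/ phi a b = -1.
Proof.
move=> Gab; have := Gab.
rewrite (root_graphE BP RP PP) => /(zero_sumP BP RP PP)[e [e1 [e2]]].
move=> [u abE eE _ _]; rewrite (edge_signE Gab abE u) /triple_sign.
rewrite (triple_constantE RP PP brP eE) /direction.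
have := flip_sign_sqr le a [:: e1; e2; e]; move: (flip_sign _ _ _) => s ss.
have s1 : s = 1 \/ s = -1 by nia.
by case: ifP => _; case: (structure_constant_sign brP eE) => ->; case: s1 => ->;
  rewrite ?mulr1 ?mul1r ?mulrN1 ?opprK; auto.
Qed.

Lemma direction_square a b c (x : {set P}) : G a b -> G b c -> G a x -> G x c ->
  direction a b * direction b c = direction a x * direction x c.
Proof.
rewrite /direction => /(root_graph_card BP RP PP)+ /(root_graph_card BP RP PP)+.
move=> + + /(root_graph_card BP RP PP)+ /(root_graph_card BP RP PP).
move: #|a| #|b| #|c| #|x| => i j k l.
by do 4 case: ifP; lia.
Qed.

Lemma edge_sign_function : sign_function G phi.
Proof.
split; [exact: edge_sign_unit | exact: edge_signC |].
move=> a b c x dia; have [_ /andP[Gab Gbc] _ /andP[Gax Gxc] _] := dia.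
have dir := direction_square Gab Gbc Gax Gxc.
have Kcst := @tetrahedron_constants _ _ _ _ _ BP RP PP _ brP a.
have [] := diamond_opposite_vertex BP RP PP brP dia.
  move=> [D1 [D2 [[z1 z2 dis] [bE cE xE]]]].
  have [/eqP/cards3P[x1 [x2 [x3 [u1 D1E]]]] _] := andP z1.
  have [/eqP/cards3P[y1 [y2 [y3 [u2 D2E]]]] _] := andP z2.
  have abE : symdiff a b = [set x1; x2; x3] by rewrite bE symdiffK.
  have bcE : symdiff b c = [set y1; y2; y3] by rewrite cE symdiffK.
  have axE : symdiff a x = [set y1; y2; y3] by rewrite xE symdiffK.
  have xcE : symdiff x c = [set x1; x2; x3].
    by rewrite cE bE xE -D1E; apply/symdiff_path/symdiffC.
  rewrite (edge_signE Gab abE u1) (edge_signE Gbc bcE u2).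
  rewrite (edge_signE Gax axE u2) (edge_signE Gxc xcE u1).
  have bw : b = flips a [:: x1; x2; x3] by rewrite bE D1E symdiff_flips.
  have xw : x = flips a [:: y1; y2; y3] by rewrite xE D2E symdiff_flips.
  have : {in [:: x1; x2; x3], forall t, t \notin [:: y1; y2; y3]}.
    move=> t tx; have : t \notin D1 :&: D2 by rewrite dis inE.
    rewrite D1E D2E !inE negb_and -!orbA; rewrite !inE in tx.
    by rewrite tx.
  move=> /(flip_sign_catC leP a); rewrite !flip_sign_cat -bw -xw.
  rewrite [(-1) ^+ _](_ : _ = -1) // mulN1r => signE.
  transitivity (direction a b * direction b c * K x1 x2 x3 * K y1 y2 y3 *
     (flip_sign le a [:: x1; x2; x3] * flip_sign le b [:: y1; y2; y3] +
      flip_sign le a [:: y1; y2; y3] * flip_sign le x [:: x1; x2; x3])).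
    by rewrite /triple_sign mulrDr {2}dir; ring.
  by rewrite signE addNr mulr0.
move=> [x1 [x2 [x3 [x4 [t [s [tet [bE cE xE]]]]]]]].
have [u1 u2 _ _] := tetrahedron_path tet.
have tet' := tetrahedronC tet; have [u3 u4 _ _] := tetrahedron_path tet'.
have u2' : uniq [:: t; x4; x3] by rewrite -rev_uniq.
have u3' : uniq [:: x1; s; x3].
  by rewrite -(rot_uniq 1) -rev_uniq.
have abE : symdiff a b = [set x1; x2; t] by rewrite bE symdiffK.
have bcE : symdiff b c = [set t; x4; x3].
  by rewrite cE symdiffK; apply/setP => y; rewrite !inE orbC orbA orbAC.
have axE : symdiff a x = [set x1; s; x3].
  by rewrite xE symdiffK setUAC.
have xcE : symdiff x c = [set x2; x4; s].
  by rewrite cE bE xE; apply/symdiff_path/(tetrahedron_symdiff tet).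
rewrite (edge_signE Gab abE u1) (edge_signE Gbc bcE u2').
rewrite (edge_signE Gax axE u3') (edge_signE Gxc xcE u4) /triple_sign.
have bw : b = flips a [:: x1; x2; t] by rewrite bE symdiff_flips.
have xw : x = flips a [:: x1; s; x3].
  by rewrite -symdiff_flips // xE setUAC.
have tt4 : flip_sign le a [:: x1; x2; t] * flip_sign le b [:: t; x4; x3] =
    flip_sign le a [:: x1; x2; x4; x3].
  rewrite bw -flip_sign_cat.
  exact: (@flip_sign_catK _ _ leP a [:: x1; x2] t [:: x4; x3]).
have [n23 n2s n34 n3s n4s] :
    [/\ x2 != x3, x2 != s, x3 != x4, x3 != s & x4 != s].
  case: (tet) => + _ _ _; rewrite /= !inE !negb_or.
  by move=> /and5P[_ /and4P[-> _ _ ->] /and3P[-> _ ->] /andP[_ ->] _].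
have ss4 : flip_sign le a [:: x1; s; x3] * flip_sign le x [:: x2; x4; s] =
    - flip_sign le a [:: x1; x2; x4; x3].
  rewrite xw -flip_sign_cat.
  rewrite (@flip_sign_catC2 _ _ leP a [:: x1; s; x3; x2] x4 s [::]) //.
  rewrite (@flip_sign_catC2 _ _ leP a [:: x1; s; x3] x2 s [:: x4]) //.
  rewrite (@flip_sign_catC2 _ _ leP a [:: x1; s] x3 s [:: x2; x4]) //.
  rewrite (@flip_sign_catK _ _ leP a [:: x1] s [:: x3; x2; x4]).
  rewrite (@flip_sign_catC2 _ _ leP a [:: x1; x2] x4 x3 [::]) 1?eq_sym //.
  by rewrite (@flip_sign_catC2 _ _ leP a [:: x1] x2 x3 [:: x4]) //= !opprK.
have {}Kcst := Kcst _ _ _ _ _ _ tet.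
have KE : K x1 x2 t * K t x4 x3 = K x1 s x3 * K x2 x4 s.
  by apply: int_mul_eq1; rewrite mulrA Kcst.
transitivity (direction a b * direction b c * (K x1 x2 t * K t x4 x3) *
    (flip_sign le a [:: x1; x2; t] * flip_sign le b [:: t; x4; x3] +
     flip_sign le a [:: x1; s; x3] * flip_sign le x [:: x2; x4; s])).
  by rewrite mulrDr {2}dir {2}KE; ring.
by rewrite tt4 ss4 subrr mulr0.
Qed.

Lemma ext_d_root_support a b : d (zbasis a) b != 0 -> G a b /\ #|a| = #|b|.+1.
Proof.
move=> /(ext_d_support leP)[p [q [x [[pa qa pq c0] [xs bE]]]]].
have xE : val x = val p + val q.
  apply/eqP; apply: contraNT c0 => /eqP xE.
  by rewrite -/(structure_constant br p q x) (structure_constant_eq0 brP).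
have px : p != x.
  apply: contraTneq (pos_neq0 RP PP (posP q)) => px.
  by rewrite negbK; apply/eqP; rewrite px in xE; vector.
have qx : q != x.
  apply: contraTneq (pos_neq0 RP PP (posP p)) => qx.
  by rewrite negbK; apply/eqP; rewrite qx in xE; vector.
have xa : x \notin a.
  by move: xs; rewrite !inE negb_and negbK ![x == _]eq_sym (negPf px) (negPf
    qx).
have u : uniq [:: p; q; x] by rewrite /= !inE negb_or pq px qx.
have abE : symdiff a b = [set p; q; x].
  apply/setP => y; rewrite in_symdiff bE !inE.
  have [->|yx] := eqVneq y x; first by rewrite (negPf xa) orbT.
  have [->|yp] := eqVneq y p; first by rewrite pa.
  by have [->|yq] := eqVneq y q; rewrite ?qa // addbb.
have qpa : (q \in a) = (p \in a) by rewrite pa qa.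
have xpa : (x \in a) = (p \notin a) by rewrite pa (negPf xa).
split; last first.
  by have := card_symdiff3 u qpa xpa; rewrite -abE symdiffK pa.
rewrite (root_graphE BP RP PP) abE (zero_sum3 _ u) /signed_root pa qa (negPf
  xa).
by rewrite xE subrr.
Qed.

Lemma root_graph_grading : graph_grading G (fun s => #|s|%:Z).
Proof. by move=> a b /(root_graph_card BP RP PP)[] ->; lia. Qed.

Lemma ext_d_edge_sign a : d (zbasis a) =
  \sum_(b : {set P} | (#|b|%:Z == #|a|%:Z - 1) && G a b) zbasis b *~ phi a b.
Proof.
apply/ffunP => b; rewrite basis_sum_coef; case: ifP => [/andP[/eqP ab Gab]|].
  by rewrite /phi ifT //; lia.
have [//|/ext_d_root_support[Gab ->]] := eqVneq (d (zbasis a) b) 0.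
by rewrite Gab andbT => /eqP; lia.
Qed.

Lemma transpose_ext_d_edge_sign a : transpose d (zbasis a) =
  \sum_(b : {set P} | (#|b|%:Z == #|a|%:Z + 1) && G a b) zbasis b *~ phi a b.
Proof.
rewrite /transpose zextend_basis.
apply/ffunP => b; rewrite basis_sum_coef ffunE;
  case: ifP => [/andP[/eqP ab Gab]|].
  by rewrite /phi ifF //; lia.
have [//|/ext_d_root_support[Gab ->]] := eqVneq (d (zbasis b) a) 0.
by rewrite (root_graph_sym BP RP PP) Gab andbT => /eqP; lia.
Qed.

End PositiveRootComplex.

Theorem theorem6p2 (F : realFieldType) (V : vectType F) (B : V -> V -> F)
    (R Rp : seq V) (le : rel (seq_sub Rp))
    (br : {ffun seq_sub Rp -> int} -> {ffun seq_sub Rp -> int} ->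
          {ffun seq_sub Rp -> int}) :
  inner_product B ->
  root_system B R ->
  positive_system R Rp ->
  root_bracket br ->
  total_order le ->
  diamond_chain_complex (root_graph Rp) (fun s => #|s|%:Z) (ext_d le br) /\
  diamond_cochain_complex (root_graph Rp) (fun s => #|s|%:Z)
    (transpose (ext_d le br)).
Proof.
move=> BP RP PP brP leP.
have GP := root_graph_diamond_graph BP RP PP brP.
have degP := root_graph_grading BP RP PP.
have phiP := edge_sign_function BP RP PP brP leP.
have dE := ext_d_edge_sign BP RP PP brP leP.
have tE := transpose_ext_d_edge_sign BP RP PP brP leP.
have dB : zmod_morphism (ext_d le br) by apply: zextend_is_zmod_morphism.
have tB : zmod_morphism (transpose (ext_d le br)).
  exact: zextend_is_zmod_morphism.
split; split=> //; try by exists (edge_sign le br).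
- split=> //; first exact: diamond_homogeneous dB dE.
  by apply: diamond_square0 dB GP degP phiP dE; right.
- split=> //; first exact: diamond_homogeneous tB tE.
  by apply: diamond_square0 tB GP degP phiP tE; left.
Qed.
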